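(* Let $\widetilde K:=\bigcup_{\gamma\in\Gamma}\operatorname{supp}(\gamma)$. Assume that there exists $\mu^\star\in\operatorname{arg\,min}_{\mu\in\mathcal{M}_+(K)}\ell(\mu)$ which is absolutely continuous with $\operatorname{supp}(\mu^\star)=\widetilde K$. Then, for any $\mu_0\in\operatorname{dom}(\ell)$ absolutely continuous with a continuous and positive density over $K$, the algorithm $\mu_{k+1}=\dfrac{\mu_k}{f}\sum_{\gamma\in\Gamma}\dfrac{\gamma}{\langle\mu_k,\gamma\rangle}$, $k\in\mathbb{N}$, is convergent in the sense that $$\ell(\mu_k)\xrightarrow[k\to+\infty]{}\min_{\mu\in\mathcal{M}_+(K)}\ell(\mu).$$ Furthermore, any weak-$*$ limit point $\bar\mu$ of $(\mu_k)_{k\in\mathbb{N}}$ satisfies $\operatorname{supp}(\bar\mu)=\widetilde K$.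
   Context: $K\subset\mathbb{R}^p$ is compact. $\mathcal{C}(K)$ is the space of continuous functions on $K$ with the sup norm $\|\cdot\|_\infty$; $\mathcal{M}(K)$ is its topological dual (Radon measures), $\mathcal{M}_+(K)$ the nonnegative measures, and $\langle\mu,g\rangle=\int_K g\,d\mu$. For $g\in\mathcal{C}(K)$, $g\mu$ is the measure with density $g$ with respect to $\mu$. ''Absolutely continuous'' means absolutely continuous with respect to the Lebesgue measure on $K$. The functions $a_1,\dots,a_m\in\mathcal{C}(K)$ are nonnegative. The operator $A:\mathcal{M}(K)\to\mathbb{R}^m$ is $(A\mu)_i=\langle\mu,a_i\rangle$; its adjoint is $A^*\lambda=\sum_i\lambda_i a_i$, and $\boldsymbol{1}=(1,\dots,1)\in\mathbb{R}^m$. For each $t\in[0,1]$, $\mathcal{W}_t:\mathcal{M}(K)\to\mathcal{M}(K)$ is a linear weak-$*$ continuous operator, with adjoint $\mathcal{W}_t^*:\mathcal{C}(K)\to\mathcal{C}(K)$ given by $\langle\mathcal{W}_t\mu,g\rangle=\langle\mu,\mathcal{W}_t^*g\rangle$. Standing assumptions: (nonnegativity preservation) $\mu\ge0\Rightarrow\mathcal{W}_t\mu\ge0$ for all $t$; (integrability) for every $g\in\mathcal{C}(K)$ the map $t\mapsto\mathcal{W}_t^*g\in\mathcal{C}(K)$ is strongly measurable, and $\int_0^1\|\mathcal{W}_t^*1\|_\infty\,dt<\infty$, where $1$ is the constant function; (positivity) the function $f:=\int_0^1\mathcal{W}_t^*A^*\boldsymbol{1}\,dt\in\mathcal{C}(K)$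 satisfies $f\ge c$ on $K$ for some constant $c>0$. Data: integers $n_i\ge0$ and times $t^i_j\in[0,1]$, $j=1,\dots,n_i$, $i=1,\dots,m$; $n=\sum_i n_i$. $\Gamma$ is the finite family (counted with multiplicity) of the $n$ functions $\mathcal{W}_{t^i_j}^*a_i\in\mathcal{C}(K)$. The function $\ell$ is defined on $\mathcal{M}_+(K)$ by $\ell(\mu)=\langle\mu,f\rangle-\sum_{\gamma\in\Gamma}\log(\langle\mu,\gamma\rangle)$ for $\mu\in\operatorname{dom}(\ell):=\{\mu\in\mathcal{M}_+(K):\langle\mu,\gamma\rangle>0\ \forall\gamma\in\Gamma\}$, and $\ell(\mu)=+\infty$ otherwise. The iterates are well defined since $\mu_k\in\operatorname{dom}(\ell)$ implies $\mu_{k+1}\in\operatorname{dom}(\ell)$. The weak-$*$ topology on $\mathcal{M}(K)$ is that of the duality with $\mathcal{C}(K)$. *)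

(* Defs.v *)
From HB Require Import structures.
From mathcomp Require Import all_boot all_order all_algebra.
From mathcomp Require Import all_classical all_reals all_analysis.
From mathcomp Require Import measurable_realfun.

Set Implicit Arguments.
Unset Strict Implicit.
Unset Printing Implicit Defensive.

Import Order.TTheory GRing.Theory Num.Theory.
Import numFieldNormedType.Exports.

Local Open Scope classical_set_scope.
Local Open Scope ring_scope.

Section borel_matrix.
Context {R : realType} (m n : nat).

Let borelC (A : set 'M[R]_(m, n)) : <<s open >> A -> <<s open >> (~` A).
Proof. by move=> mA; rewrite -setTD; exact: sigma_algebraCD. Qed.

HB.instance Definition _ := @isMeasurable.Build default_measure_display
  'M[R]_(m, n) <<s open >> (@sigma_algebra0 _ setT _) borelC
  (@sigma_algebra_bigcup _ setT _).

Lemma open_measurable_mx (A : set 'M[R]_(m, n)) : open A -> measurable A.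
Proof. exact: sub_sigma_algebra. Qed.

Lemma closed_measurable_mx (A : set 'M[R]_(m, n)) : closed A -> measurable A.
Proof.
by move=> /closed_openC/open_measurable_mx/measurableC; rewrite setCK.
Qed.

Lemma measurable_fun_mx d (T : measurableType d) (f : T -> 'M[R]_(m, n)) :
  (forall U, open U -> measurable (f @^-1` U)) -> measurable_fun setT f.
Proof.
move=> mf; apply: (@measurability _ _ T 'M[R]_(m, n) _ _ open) => //.
by move=> _ [U oU <-]; rewrite setTI; exact: mf.
Qed.

Lemma continuous_measurable_mx (f : 'M[R]_(m, n) -> R) :
  continuous f -> measurable_fun setT f.
Proof.
move=> /continuousP cf; apply: (measurability _ (RGenOpens.measurableE R)).
move=> _ [_ [a [b ->] <-]]; rewrite setTI; apply: open_measurable_mx.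
exact/cf/interval_open.
Qed.

End borel_matrix.

(* The Lebesgue measure of R^(p+1) is the image of the product of those of R
   and R^p under (x, v) |-> (x, v_0, ..., v_(p-1)). *)
Section lebesgue_rV_succ.
Context {R : realType} {p : nat}.

Definition rV_cons (xv : measurableTypeR R * 'rV[R]_p) : 'rV[R]_p.+1 :=
  row_mx (xv.1%:M : 'rV_1) xv.2.

Lemma rV_cons0 xv : rV_cons xv ord0 ord0 = xv.1.
Proof.
transitivity (row_mx (xv.1%:M : 'rV_1) xv.2 ord0 (lshift p ord0)).
  by congr fun_of_matrix; exact: val_inj.
by rewrite row_mxEl mxE eqxx mulr1n.
Qed.

Lemma rV_consS xv i : rV_cons xv ord0 (lift ord0 i) = xv.2 ord0 i.
Proof.
transitivity (row_mx (xv.1%:M : 'rV_1) xv.2 ord0 (rshift 1 i)).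
  by congr fun_of_matrix; exact: val_inj.
by rewrite row_mxEr.
Qed.

Lemma rV_cons_measurable : measurable_fun setT rV_cons.
Proof.
apply: measurable_fun_mx => U oU.
pose e (n : nat) : R := n.+1%:R^-1.
have e_gt0 n : 0 < e n by rewrite invr_gt0.
pose B (i : rat * 'rV[rat]_p * nat) : set (measurableTypeR R * 'rV[R]_p) :=
  ball (ratr i.1.1 : R) (e i.2) `*` ball (map_mx ratr i.1.2 : 'rV[R]_p) (e i.2).
have -> : rV_cons @^-1` U =
    \bigcup_(i in [set i | B i `<=` rV_cons @^-1` U]) B i.
  apply/seteqP; split => [[x v] /= Uxv|xv [i] /=]; last by move=> + Bi; apply.
  have /nbhs_ballP[r /= r0 rU] : nbhs (rV_cons (x, v) : 'rV[R]_p.+1) U.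
    exact: open_nbhs_nbhs.
  have [n nr] : exists n : nat, 2 * e n < r.
    exists (Num.truncn (2 / r)); rewrite /e ltr_pdivrMr ?ltr0n//.
    by rewrite mulrC -ltr_pdivrMr// truncnS_gt// divr_ge0// ltW.
  have apx (y : R) : {q : rat | `|y - ratr q| < e n}.
    apply: cid; have /rat_in_itvoo[q] : y - e n < y + e n.
      by rewrite ltrBlDr -addrA ltrDl addr_gt0.
    rewrite in_itv/= => /andP[q1 q2]; exists q.
    by rewrite ltr_distlC q1 q2.
  pose q := \row_j sval (apx (v ord0 j)).
  have tri (a b c : R) : `|c - a| < e n -> `|c - b| < e n -> `|a - b| < r.
    rewrite (distrC c a) => ac cb; apply: le_lt_trans (ler_distD c a b) _.
    by apply: lt_trans nr; rewrite mulr_natl mulr2n ltrD.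
  have qx : `|ratr (sval (apx x)) - x| < e n.
    by rewrite distrC; exact: (svalP (apx x)).
  have qv j : `|map_mx ratr q ord0 j - v ord0 j| < e n.
    by rewrite !mxE distrC; exact: (svalP (apx (v ord0 j))).
  exists (sval (apx x), q, n) => /=; last first.
    by split => /=; [exact: qx|split => // i j; rewrite ord1; exact: qv].
  move=> [y w] [/= qy [_ qw]]; apply: rU; split => // i j; rewrite ord1.
  rewrite /ball/=; case: (unliftP ord0 j) => [k|] ->.
    by rewrite !rV_consS/=; apply: tri (qv k) (qw ord0 k).
  by rewrite !rV_cons0/=; exact: tri qx qy.
rewrite bigcup_mkcond; apply: countable_bigcupT_measurable => [|i].
  exact: countableP.
case: ifPn => _ //; apply: measurableX.
  by apply: open_measurable; exact: ball_open.
by apply: open_measurable_mx; exact: ball_open.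
Qed.

Context (mu : {sigma_finite_measure set 'rV[R]_p -> \bar R}).

Definition lebesgue_rV_succ : set 'rV[R]_p.+1 -> \bar R :=
  pushforward (lebesgue_measure \x mu)%E rV_cons.

Let pre A : measurable A -> measurable (rV_cons @^-1` A).
Proof. by move=> mA; rewrite -[X in measurable X]setTI; exact: rV_cons_measurable. Qed.

Let succ0 : lebesgue_rV_succ set0 = 0%E.
Proof. by rewrite /lebesgue_rV_succ /pushforward preimage_set0 measure0. Qed.

Let succ_ge0 A : (0 <= lebesgue_rV_succ A)%E.
Proof. by apply: (@measure_ge0 _ _ _ (lebesgue_measure \x mu)%E). Qed.

Let succ_sigma_additive : semi_sigma_additive lebesgue_rV_succ.
Proof.
move=> F mF tF mUF; rewrite /lebesgue_rV_succ /pushforward preimage_bigcup.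
apply: measure_semi_sigma_additive.
- by move=> n; exact: pre.
- apply/trivIsetP => i j _ _ ij; rewrite -preimage_setI.
  by move/trivIsetP : tF => ->; rewrite ?preimage_set0.
- by rewrite -preimage_bigcup; exact: pre.
Qed.

HB.instance Definition _ := isMeasure.Build _ _ _ lebesgue_rV_succ
  succ0 succ_ge0 succ_sigma_additive.

Let uncons (w : 'rV[R]_p.+1) : measurableTypeR R * 'rV[R]_p :=
  (w ord0 ord0, \row_j w ord0 (lift ord0 j)).

Let unconsK : cancel rV_cons uncons.
Proof.
move=> [x v]; rewrite /uncons rV_cons0; congr pair.
by apply/rowP => j; rewrite mxE rV_consS.
Qed.

Let uncons_measurable : measurable_fun setT uncons.
Proof.
apply/measurable_fun_pairP; split => /=.
  by apply: continuous_measurable_mx; exact: coord_continuous.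
apply: measurable_fun_mx => U oU; apply: open_measurable_mx.
rewrite openE => w /= Uw.
have /nbhs_ballP[r /= r0 rU] : nbhs (\row_j w ord0 (lift ord0 j) : 'rV[R]_p) U.
  exact: open_nbhs_nbhs.
apply/nbhs_ballP; exists r => //= w' [_ ww']; apply: rU; split => // i j.
by rewrite !mxE; exact: ww'.
Qed.

Let succ_sigma_finite : sigma_finite setT lebesgue_rV_succ.
Proof.
have /sigma_finiteP[F [FT ndF Foo]] := sigma_finiteT (@lebesgue_measure R).
have /sigma_finiteP[G [GT ndG Goo]] := sigma_finiteT mu.
have pK A : rV_cons @^-1` (uncons @^-1` A) = A.
  by rewrite -comp_preimage; apply/seteqP; split => xv /=; rewrite unconsK.
exists (fun n => uncons @^-1` (F n `*` G n)).
  apply/esym/seteqP; split => // w _.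
  have : [set: R] (uncons w).1 by [].
  have : [set: 'rV[R]_p] (uncons w).2 by [].
  rewrite {1}FT {1}GT => -[j _ Gj] [i _ Fi]; exists (maxn i j) => //; split.
    by apply: (subsetPset _ _ (ndF _ _ _) _ Fi); exact: leq_maxl.
  by apply: (subsetPset _ _ (ndG _ _ _) _ Gj); exact: leq_maxr.
move=> n; have [mF Fn] := Foo n; have [mG Gn] := Goo n; split.
  rewrite -[X in measurable X]setTI; apply: uncons_measurable => //.
  exact: measurableX.
rewrite /lebesgue_rV_succ /pushforward pK product_measure1E//.
by rewrite lte_mul_pinfty// ge0_fin_numE.
Qed.

HB.instance Definition _ := Measure_isSigmaFinite.Build _ _ _ lebesgue_rV_succ
  succ_sigma_finite.

End lebesgue_rV_succ.

Fixpoint lebesgue_rV {R : realType} (p : nat) :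
    {sigma_finite_measure set 'rV[R]_p -> \bar R} :=
  if p is q.+1 then lebesgue_rV_succ (lebesgue_rV q) else \d_(0 : 'rV[R]_0).

Lemma lebesgue_rV_box {R : realType} (p : nat) (a b : 'rV[R]_p) :
  (forall i, a ord0 i <= b ord0 i) ->
  lebesgue_rV p [set v | forall i, a ord0 i <= v ord0 i <= b ord0 i] =
  (\prod_i (b ord0 i - a ord0 i))%:E.
Proof.
elim: p a b => [|p IHp] a b ab.
  by rewrite big_ord0 /= diracE mem_set// => -[].
pose a' := \row_j a ord0 (lift ord0 j); pose b' := \row_j b ord0 (lift ord0 j).
pose B' := [set v : 'rV[R]_p | forall i, a' ord0 i <= v ord0 i <= b' ord0 i].
have mB' : measurable B'.
  rewrite (_ : B' = \bigcap_(i in [set: 'I_p])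
      [set v : 'rV[R]_p | v ord0 i \in `[a' ord0 i, b' ord0 i]]); last first.
    apply/seteqP; split => v /= Bv; first by move=> i _; rewrite /= in_itv; exact: Bv.
    by move=> i; have := Bv i I; rewrite /= in_itv.
  apply: fin_bigcap_measurable; first exact: finite_finset.
  move=> i _; rewrite -[X in measurable X]setTI.
  have /continuous_measurable_mx := @coord_continuous R 1 p ord0 i.
  by move=> /(_ measurableT _ (measurable_itv `[a' ord0 i, b' ord0 i])).
rewrite /= /lebesgue_rV_succ /pushforward (_ : rV_cons @^-1` _ =
    `[a ord0 ord0, b ord0 ord0] `*` B'); last first.
  apply/seteqP; split => [xv /= Bxv|xv /= [xab Bv] i].
    split; first by have := Bxv ord0; rewrite rV_cons0 /= in_itv.
    by move=> i; rewrite !mxE; have := Bxv (lift ord0 i); rewrite rV_consS.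
  have [j ->|->] := unliftP ord0 i.
    by rewrite rV_consS; have := Bv j; rewrite !mxE.
  by move: xab; rewrite rV_cons0 in_itv.
rewrite product_measure1E// [X in (_ * X)%E]IHp; last by move=> i; rewrite !mxE.
rewrite big_ord_recl EFinM; congr (_ * _)%E.
  rewrite [LHS]lebesgue_measure_itv/= lte_fin; case: ltgtP (ab ord0) => // -> _.
  by rewrite subrr.
by congr EFin; apply: eq_bigr => i _; rewrite !mxE.
Qed.

Section radon_measures.
Context {R : realType} {p : nat} (K : set 'rV[R]_p).

Definition supnorm (g : K -> R) : R := sup [set `|g x| | x in [set: K]].

(* The support is taken in R^p; since K is closed it is also the support in K. *)
Definition fun_support (g : K -> R) : set 'rV[R]_p :=
  closure (set_val @` [set x | g x != 0]).

(* A Radon measure on K is a finite signed Borel measure on R^p that is carried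
   by K; it is a function on all sets, but only its values on Borel sets are
   meaningful. *)
Record radon := Radon {
  radon_charge :> {charge set 'rV[R]_p -> \bar R} ;
  radon_carried : forall A, measurable A -> A `&` K = set0 ->
    radon_charge A = 0%E }.

HB.instance Definition _ := gen_eqMixin radon.
HB.instance Definition _ := gen_choiceMixin radon.

Definition is_lincomb (c : R) (mu nu rho : radon) :=
  forall A, measurable A -> rho A = (c%:E * mu A + nu A)%E.

Definition radon_nonneg : set radon :=
  [set mu | forall A, measurable A -> (0 <= mu A)%E].

Definition hahn_sets (mu : radon) :
  {PN : set 'rV[R]_p * set 'rV[R]_p | hahn_decomposition mu PN.1 PN.2}.
Proof. by apply: cid; have [P [N PN]] := Hahn_decomposition mu; exists (P, N). Qed.

(* The integral over D of g, extended by 0 outside K, against the signed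
   measure mu; it does not depend on the Hahn decomposition. *)
Definition radon_int (mu : radon) (D : set 'rV[R]_p) (g : K -> R) : R :=
  \int[jordan_pos (svalP (hahn_sets mu))]_(x in D) valL_ 0 g x -
  \int[jordan_neg (svalP (hahn_sets mu))]_(x in D) valL_ 0 g x.

Definition pairing (mu : radon) (g : K -> R) : R := radon_int mu K g.

Definition is_density (mu : radon) (g : K -> R) (nu : radon) :=
  forall A, measurable A -> nu A = (radon_int mu (A `&` K) g)%:E.

Definition weak_star : Type := initial_topology
  (fun mu : radon => (fun g => pairing mu g) : {ptws continuousType K R -> R}).
HB.instance Definition _ := Topological.copy radon weak_star.

Lemma weak_star_cvgP (F : set_system radon) (mu : radon) : Filter F ->
  F --> mu <-> forall g : continuousType K R,
    pairing nu g @[nu --> F] --> pairing mu g.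
Proof.
move=> FF; pose ph := (fun nu : radon => (fun g => pairing nu g) :
  {ptws continuousType K R -> R}).
have cph : continuous ph by exact: initial_continuous.
split.
  move=> Fm g; have c : continuous (fun nu : radon => pairing nu g).
    move=> nu; apply: (@cvg_comp _ _ _ ph (fun h => h g)); first exact: cph.
    exact: (@proj_continuous _ (fun _ : continuousType K R => R) g).
  by apply: cvg_trans (c mu); exact: cvg_app.
move=> H; have phF : ph nu @[nu --> F] --> ph mu.
  apply/cvg_sup => g A [B [[C oC <-] /= Bmu BA]].
  have := H g C (open_nbhs_nbhs (conj oC Bmu)).
  by rewrite /= nbhs_simpl/=; apply: filterS => nu Cnu; apply: BA.
move=> A [B [[C oC <-] /= Bmu BA]].
have := phF C (open_nbhs_nbhs (conj oC Bmu)).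
by rewrite /= nbhs_simpl/=; apply: filterS.
Qed.

(* The complement of the largest open set all of whose Borel subsets are null,
   i.e. which is null for the total variation. *)
Definition radon_support (mu : radon) : set 'rV[R]_p :=
  [set x | forall U : set 'rV[R]_p, open U -> U x ->
    exists A : set 'rV[R]_p, [/\ measurable A, A `<=` U & mu A != 0%E]].

Definition lebesgue_on (A : set 'rV[R]_p) : \bar R := lebesgue_rV p (A `&` K).

Definition abs_continuous (mu : radon) := mu `<< lebesgue_on.

Definition has_lebesgue_density (mu : radon) (h : K -> R) :=
  forall A, measurable A ->
    mu A = (\int[lebesgue_rV p]_(x in A `&` K) (valL_ 0 h x)%:E)%E.

End radon_measures.

Section bochner.
Context {R : realType} {p : nat} (K : set 'rV[R]_p).

(* t |-> \sum_i \1_(sf_set i) t * sf_val i, a C(K)-valued simple function. *)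
Record simple_fun := SimpleFun {
  sf_size : nat ;
  sf_set : 'I_sf_size -> set (measurableTypeR R) ;
  sf_val : 'I_sf_size -> continuousType K R ;
  sf_measurable : forall i, measurable (sf_set i) }.

Definition sf_eval (s : simple_fun) (t : R) : K -> R :=
  fun x => \sum_i \1_(sf_set i) t * sf_val (s := s) i x.

Definition sf_integral (s : simple_fun) : K -> R :=
  fun x => \sum_i
    fine (lebesgue_measure (sf_set i `&` `[0, 1])) * sf_val (s := s) i x.

Definition ae_limit (s : nat -> simple_fun) (h : R -> continuousType K R) :=
  \forall t \ae lebesgue_measure, `[0, 1]%classic t ->
    supnorm (sf_eval (s n) t \- h t) @[n --> \oo] --> (0 : R).

Definition strongly_measurable (h : R -> continuousType K R) :=
  exists s, ae_limit s h.

Definition is_bochner_integral (h : R -> continuousType K R)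
    (F : continuousType K R) :=
  exists s, [/\ ae_limit s h,
    (\int[lebesgue_measure]_(t in `[0%R, 1%R]) (supnorm (sf_eval (s n) t \- h t))%:E)%E
      @[n --> \oo] --> 0%E &
    supnorm (sf_integral (s n) \- F) @[n --> \oo] --> (0 : R)].

End bochner.

Section likelihood.
Context {R : realType} {p : nat} {K : set 'rV[R]_p}.

Section adjoint.
Context {m : nat} (a : 'I_m -> continuousType K R) (lam : 'rV[R]_m).

Lemma adjoint_continuous :
  continuous ((fun x => \sum_i lam ord0 i * a i x) : K -> R).
Proof.
elim: (index_enum 'I_m) => [|i s IHs].
  rewrite (_ : (fun _ => _) = cst 0); first exact: cst_continuous.
  by apply/funext => x; rewrite big_nil.
rewrite (_ : (fun _ => _) = fun x => lam ord0 i * a i x +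
    \sum_(i <- s) lam ord0 i * a i x); last first.
  by apply/funext => x; rewrite big_cons.
move=> x; have Fx : Filter (nbhs x) by exact: nbhs_filter.
apply: (cvgD _ (IHs x)); apply: cvgM; first exact: cvg_cst.
exact: (@cts_fun _ _ (a i) x).
Qed.

(* A^* lam, where (A mu)_i = <mu, a_i> *)
Definition adjointA : continuousType K R := mkcts adjoint_continuous.

End adjoint.

(* The family Gamma, indexed by the pairs (i, j) and hence counted with
   multiplicity; tt i j is the time t^i_j. *)
Definition gammas {m : nat} (Wadj : R -> continuousType K R -> continuousType K R)
    (a : 'I_m -> continuousType K R) (n : 'I_m -> nat)
    (tt : forall i, 'I_(n i) -> R) (s : {i : 'I_m & 'I_(n i)}) :
  continuousType K R := Wadj (tt (tag s) (tagged s)) (a (tag s)).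

Context {I : finType} (f : continuousType K R) (gam : I -> continuousType K R).

Definition Ktilde : set 'rV[R]_p := \bigcup_i fun_support (gam i).

Definition ell_dom : set (radon K) :=
  [set mu | radon_nonneg mu /\ forall i, 0 < pairing mu (gam i)].

Definition ell (mu : radon K) : \bar R :=
  if mu \in ell_dom then (pairing mu f - \sum_i ln (pairing mu (gam i)))%:E
  else +oo%E.

Definition ell_argmin : set (radon K) :=
  [set mu | radon_nonneg mu /\ forall nu, radon_nonneg nu -> (ell mu <= ell nu)%E].

Definition ell_min : \bar R := ereal_inf [set ell nu | nu in @radon_nonneg R p K].

Definition em_step (mu nu : radon K) :=
  is_density mu (fun x => (f x)^-1 * \sum_i gam i x / pairing mu (gam i)) nu.

End likelihood.

(* Main.v *)
(* Write G_k for the density of mu_k with respect to mu_0 and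
   u_k,i = <mu_k, gamma_i>, v_i = <mu_star, gamma_i>. Optimality of mu_star
   gives f = sum_i gamma_i / v_i mu_star-almost everywhere, so Jensen's
   inequality for the weights gamma_i / (v_i f) yields, pointwise,
     sum_i gamma_i / v_i * sum_(k < N) ln (v_i / u_k,i) <= f * ln G_N.
   The integral of the left-hand side against mu_star is
   sum_(k < N) (ell mu_k - ell mu_star), up to the term k = 0. Since
   ln y <= y / s + ln s - 1, the integral of the right-hand side is bounded
   as soon as mu_star has a bounded density with respect to mu_0, because
   <mu_N, f> is the number of gammas; hence ell mu_k - ell mu_star is summable.
   If mu_N had little mass near a point of the support of mu_star, a small s
   near that point would make the right-hand side arbitrarily negative, which
   gives the support of the limit points.

   The density of mu_star need not be bounded (the relative entropy of mu_star
   with respect to mu_0 may be infinite), but only its integrals against the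
   gammas and the set where it vanishes matter, and truncating it changes these
   integrals by a small amount that can be compensated by a small bounded
   perturbation. *)

Require Import Defs.
From mathcomp Require Import all_boot all_order all_algebra.
From mathcomp Require Import all_classical all_reals all_analysis.
From mathcomp Require Import measurable_realfun ring lra.

Import Order.TTheory GRing.Theory Num.Theory.
Import numFieldNormedType.Exports.

Local Open Scope classical_set_scope.
Local Open Scope ring_scope.

Set Implicit Arguments.
Unset Strict Implicit.

(** * Bounded measurable functions on a finite measure space *)

Section bounded_measurable.
Context d (T : measurableType d) (R : realType).
Implicit Types (g h : T -> R) (mu : {measure set T -> \bar R}).

Definition bounded_measurable g :=
  measurable_fun setT g /\ exists M, forall x, `|g x| <= M.

Lemma bounded_measurable_cst (c : R) : bounded_measurable (fun=> c).
Proof. by split; [exact: measurable_cst|exists `|c|]. Qed.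

Lemma bounded_measurableD g h : bounded_measurable g -> bounded_measurable h ->
  bounded_measurable (fun x => g x + h x).
Proof.
move=> [mg [M gM]] [mh [N hN]]; split; first exact: measurable_funD.
by exists (M + N) => x; rewrite (le_trans (ler_normD _ _))// lerD.
Qed.

Lemma bounded_measurableM g h : bounded_measurable g -> bounded_measurable h ->
  bounded_measurable (fun x => g x * h x).
Proof.
move=> [mg [M gM]] [mh [N hN]]; split; first exact: measurable_funM.
by exists (M * N) => x; rewrite normrM ler_pM.
Qed.

Lemma bounded_measurableZ (c : R) g : bounded_measurable g ->
  bounded_measurable (fun x => c * g x).
Proof. by apply: bounded_measurableM; exact: bounded_measurable_cst. Qed.

Lemma bounded_measurableN g : bounded_measurable g ->
  bounded_measurable (fun x => - g x).
Proof.
move=> /(bounded_measurableZ (-1)); congr bounded_measurable.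
by apply/funext => x; rewrite mulN1r.
Qed.

Lemma bounded_measurable_sum (I : Type) (s : seq I) (g : I -> T -> R) :
  (forall i, bounded_measurable (g i)) ->
  bounded_measurable (fun x => \sum_(i <- s) g i x).
Proof.
move=> bg; elim: s => [|i s IHs].
  under eq_fun do rewrite big_nil; exact: bounded_measurable_cst.
under eq_fun do rewrite big_cons; exact: bounded_measurableD.
Qed.

Lemma bounded_measurable_indic (A : set T) : measurable A ->
  bounded_measurable (\1_A : T -> R).
Proof.
move=> mA; split; first exact: measurable_indic.
by exists 1 => x; rewrite indicE; case: (_ \in _); rewrite ?normr1 ?normr0.
Qed.

Lemma bounded_measurable_minr g (M : R) : measurable_fun setT g ->
  (forall x, 0 <= g x) -> bounded_measurable (fun x => Num.min (g x) M).
Proof.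
move=> mg g0; split; first exact: measurable_minr.
exists `|M| => x; rewrite ler_norml; apply/andP; split.
  by rewrite le_min (le_trans _ (g0 x)) ?oppr_le0// lerNl -normrN ler_norm.
by rewrite ge_min ler_norm orbT.
Qed.

(** The dichotomy is that of a function bounded below by [c] on a set and extended by zero; as the
    inverse of 0 is 0, the reciprocal never exceeds [c^-1]. *)
Lemma bounded_measurableV (c : R) g : bounded_measurable g -> 0 < c ->
  (forall x, g x = 0 \/ c <= g x) -> bounded_measurable (fun x => (g x)^-1).
Proof.
move=> [mg _] c0 gc; have g0 x : 0 <= g x.
  by case: (gc x) => [->//|]; apply: le_trans; exact: ltW.
split.
  rewrite (_ : (fun _ => _) = fun x => powR (g x) (- 1)).
    by apply: (measurableT_comp (measurable_powR (-1))).
  by apply/funext => x; rewrite powR_inv1.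
exists c^-1 => x; rewrite ger0_norm ?invr_ge0//.
case: (gc x) => [->|cg]; first by rewrite invr0 invr_ge0 ltW.
by rewrite lef_pV2// posrE// (lt_le_trans c0).
Qed.

Lemma bounded_bounded_measurable g : bounded_measurable g ->
  [bounded g x | x in [set: T]].
Proof.
move=> [_ [M gM]]; exists M; split; first exact: num_real.
by move=> N MN x _; apply: le_trans (gM x) _; exact: ltW.
Qed.

Lemma bounded_measurable_integrable (mu : {finite_measure set T -> \bar R}) g D :
  measurable D -> bounded_measurable g -> mu.-integrable D (EFin \o g).
Proof.
move=> mD bg; apply: (integrableS measurableT) => //.
apply: measurable_bounded_integrable => //.
- by rewrite ltey_eq fin_num_measure.
- by case: bg.
- exact: bounded_bounded_measurable.
Qed.

Lemma bounded_measurable_integrableM mu g h :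
  bounded_measurable g -> mu.-integrable setT (EFin \o h) ->
  mu.-integrable setT (EFin \o (fun x => g x * h x)).
Proof.
move=> [mg bg] ih; have := @integrableMl _ _ _ mu setT measurableT _ _ ih mg
  (bounded_bounded_measurable (conj mg bg)).
by apply: eq_integrable => // x _ /=; rewrite EFinM muleC.
Qed.

Lemma Rintegral_sum mu (I : Type) (s : seq I) (g : I -> T -> R) :
  (forall i, mu.-integrable setT (EFin \o g i)) ->
  \int[mu]_x (\sum_(i <- s) g i x) = \sum_(i <- s) \int[mu]_x g i x.
Proof.
move=> ig; elim: s => [|i s IHs].
  under eq_Rintegral do rewrite big_nil.
  by rewrite big_nil Rintegral_cst// mul0r.
under eq_Rintegral do rewrite big_cons.
rewrite big_cons -IHs RintegralD//; have := integrable_sum measurableT s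
  (fun j (_ : xpredT j) => ig j).
by apply: eq_integrable => // x _ /=; rewrite sumEFin.
Qed.

Lemma Rintegral_eq0 mu g : mu.-integrable setT (EFin \o g) ->
  (forall x, 0 <= g x) -> \int[mu]_x g x = 0 -> mu [set x | g x != 0] = 0.
Proof.
move=> ig g0 g_int0; have mg := measurable_int _ ig.
have : (\int[mu]_x `|(EFin \o g) x| = 0)%E.
  rewrite -[LHS]fineK; last exact/integrable_fin_num/integrable_abse.
  congr EFin; rewrite -[RHS]g_int0; congr fine; apply: eq_integral => x _ /=.
  by rewrite ger0_norm.
move=> /ae_eq_integral_abs -/(_ measurableT mg)[N [mN N0 gN]].
apply: (subset_measure0 _ mN _ N0).
  have := emeasurable_neq measurableT mg 0%E.
  by rewrite setTI; congr measurable; apply/seteqP; split=> x /=; rewrite eqe.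
by move=> x /= /eqP gx; apply: gN => /= /(_ I)[]/gx.
Qed.

Lemma eq_Rintegral_null mu g h (N : set T) : measurable N -> mu N = 0 ->
  measurable_fun setT g -> measurable_fun setT h ->
  (forall x, ~ N x -> g x = h x) -> \int[mu]_x g x = \int[mu]_x h x.
Proof.
move=> mN N0 mg mh gh; congr fine; apply: ae_eq_integral => //.
- exact/measurable_EFinP.
- exact/measurable_EFinP.
- by exists N; split => // x /= /not_implyP[_ ne]; apply: contrapT => /gh gh_x;
    apply: ne; rewrite gh_x.
Qed.

(* The library's change of variables is stated for the chosen Radon-Nikodym
   derivative, which is only almost everywhere equal to h. *)
Lemma Rintegral_density (nu mu : {finite_measure set T -> \bar R}) g h :
  (forall x, 0 <= h x) -> mu.-integrable setT (EFin \o h) ->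
  (forall A, measurable A -> nu A = \int[mu]_(x in A) (h x)%:E)%E ->
  bounded_measurable g ->
  \int[nu]_x g x = \int[mu]_x (g x * h x).
Proof.
move=> h0 ih nuh bg; have mh := measurable_int _ ih; have [mg _] := bg.
have numu : nu `<< mu.
  apply/null_content_dominatesP => A mA A0; rewrite nuh//.
  by rewrite null_set_integral//; exact: measurable_funTS.
congr fine; rewrite -(Radon_Nikodym_change_of_variables numu)//; last first.
  exact: bounded_measurable_integrable.
apply: ae_eq_integral => //.
- by apply: emeasurable_funM; [exact/measurable_EFinP|].
- by apply/measurable_EFinP; apply: measurable_funM => //; exact/measurable_EFinP.
- have : ae_eq mu setT (Radon_Nikodym (charge_of_finite_measure nu) mu) (EFin \o h).
    apply: integral_ae_eq => //; first exact: Radon_Nikodym_integrable.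
    move=> A _ mA.
    by rewrite -Radon_Nikodym_integral//; exact: nuh.
  by apply: filterS => x /= /(_ I) -> _; rewrite EFinM.
Qed.

End bounded_measurable.

(** * Inequalities for the logarithm *)

Section logarithm.
Context (R : realType).
Implicit Types s y z : R.

Lemma ln_le_tangent s y : 0 < s -> 0 < y -> ln y <= y / s + ln s - 1.
Proof.
move=> s0 y0; have ys : 0 < y / s by rewrite divr_gt0.
rewrite -[y in leLHS](divfK (lt0r_neq0 s0)) lnM ?posrE//.
rewrite addrAC lerD2r -{1}(subrKC 1 (y / s)) le_ln1Dx//.
by rewrite ltrBrDl addrN.
Qed.

(** Each logarithm is bounded by the tangent at the weighted mean [f^-1 * S]; after summation the
    linear and constant terms cancel. The weights have total [f] instead of 1 because the inequality
    is applied pointwise. *)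
Lemma weighted_jensen_ln (I : finType) (w y : I -> R) (f : R) :
  (forall i, 0 <= w i) -> (forall i, 0 < y i) -> \sum_i w i = f -> 0 < f ->
  0 < \sum_i w i * y i /\
  \sum_i w i * ln (y i) <= f * ln (f^-1 * \sum_i w i * y i).
Proof.
move=> w0 y0 wf f0; set S := \sum_i w i * y i.
have S0 : 0 < S.
  have [i wi] : exists i, w i != 0.
    apply: contrapT => /forallNP wi0; move: f0.
    by rewrite -wf big1 ?ltxx// => i _; apply/eqP/negP => /negP/wi0.
  rewrite /S (bigD1 i)//= ltr_wpDr//; last by rewrite mulr_gt0// lt0r wi w0.
  by apply: sumr_ge0 => j _; rewrite mulr_ge0// ltW.
split=> //; have g0 : 0 < f^-1 * S by rewrite mulr_gt0// invr_gt0.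
apply: (@le_trans _ _ (\sum_i w i * (y i / (f^-1 * S) + ln (f^-1 * S) - 1))).
  by apply: ler_sum => i _; rewrite ler_wpM2l// ln_le_tangent.
under eq_bigr do rewrite -addrA mulrDr mulrA.
rewrite big_split/= -!mulr_suml -/S wf.
rewrite (_ : S / _ = f); first by rewrite mulrBr mulr1 addrC subrK.
by field; rewrite !lt0r_neq0.
Qed.

Lemma ln1B_ge z : `|z| <= 2^-1 -> - z - 2 * z ^+ 2 <= ln (1 - z).
Proof.
rewrite ler_norml => /andP[z1 z2]; have z3 : 0 < 1 - z by lra.
have := @ln_le_tangent 1 (1 - z)^-1 ltr01; rewrite invr_gt0 => /(_ z3).
rewrite lnV ?posrE// ln1 divr1 addr0 => lnz.
have : (1 - z)^-1 <= 1 + z + 2 * z ^+ 2.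
  by rewrite -[leLHS]mul1r ler_pdivrMr//; nra.
lra.
Qed.

(** The sum of logarithms has right derivative [- \sum_i z i] at 0, and it is compared there with
    the slope [- b]; [ln1B_ge] controls the second-order remainder. *)
Lemma sum_ln1B_derivative (I : finType) (z : I -> R) (b : R) :
  (\forall t \near (0 : R)^'+, \sum_i ln (1 - t * z i) <= - t * b) ->
  b <= \sum_i z i.
Proof.
move=> H; apply/ler_addgt0Pr => e e0.
pose Z := \sum_i `|z i|; pose Y := \sum_i z i ^+ 2.
have Z0 : 0 <= Z by exact: sumr_ge0.
have Y0 : 0 <= Y by apply: sumr_ge0 => i _; exact: sqr_ge0.
near (0 : R)^'+ => t.
have t0 : 0 < t by near: t; exact: nbhs_right_gt.
(* [tZ] keeps every [t * z i] within 1/2 of 0, as [ln1B_ge] requires; [tY] makes the remainder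
   [2 * t * Y] at most [e]. *)
have tZ : t <= (2 * (Z + 1))^-1.
  by near: t; apply: nbhs_right_le; rewrite invr_gt0 mulr_gt0// ltr_wpDl.
have tY : t <= e / (2 * (Y + 1)).
  by near: t; apply: nbhs_right_le; rewrite divr_gt0// mulr_gt0// ltr_wpDl.
have tH : \sum_i ln (1 - t * z i) <= - t * b by near: t.
have : \sum_i (- (t * z i) - 2 * (t * z i) ^+ 2) <= - t * b.
  apply: le_trans tH; apply: ler_sum => i _; apply: ln1B_ge.
  have zZ : `|z i| <= Z by rewrite /Z (bigD1 i)//= lerDl sumr_ge0.
  rewrite normrM gtr0_norm//; apply: (@le_trans _ _ ((2 * (Z + 1))^-1 * (Z + 1))).
    by rewrite ler_pM// ?ltW//; lra.
  by rewrite invfM mulfVK// gt_eqF// ltr_wpDl.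
rewrite (_ : \sum_i _ = - t * (\sum_i z i + 2 * t * Y)); last first.
  rewrite mulr_sumr -big_split mulr_sumr; apply: eq_bigr => i _ /=; ring.
rewrite !mulNr lerN2 ler_pM2l// => /le_trans; apply; rewrite lerD2l.
have : t * (2 * (Y + 1)) <= e by rewrite -ler_pdivlMr// mulr_gt0// ltr_wpDl.
nra.
Unshelve. all: by end_near. Qed.

End logarithm.

(** * Replacing a density by a bounded one *)

Section bounded_density.
Context d (T : measurableType d) (R : realType).
Context (mu : {finite_measure set T -> \bar R}).

Lemma cvg_Rintegral_truncation (r : T -> R) : (forall x, 0 <= r x) ->
  mu.-integrable setT (EFin \o r) ->
  \int[mu]_x (r x - Num.min (r x) n%:R) @[n --> \oo] --> (0 : R).
Proof.
move=> r0 ir; have mr : measurable_fun setT r by exact/measurable_EFinP/(measurable_int _ ir).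
have [|||||_ _] := @dominated_convergence _ _ _ mu setT measurableT
    (fun n x => (r x - Num.min (r x) n%:R)%:E) (cst 0) (EFin \o r).
- by move=> n; apply/measurable_EFinP/measurable_funB => //; exact: measurable_minr.
- exact: measurable_cst.
- apply: aeW => x _; apply: cvg_near_cst; near=> n.
  rewrite min_l ?subrr//; near: n; exact: nbhs_infty_ger.
- exact: ir.
- apply: aeW => x n _; rewrite lee_fin ger0_norm ?subr_ge0 ?ge_min ?lexx//.
  by rewrite gerBl le_min r0 ler0n.
rewrite integral_cst// mul0e => /fine_cvgP[_] /=.
by apply: cvg_trans; apply: near_eq_cvg; exact: nearW.
Unshelve. all: by end_near. Qed.

Context (q : nat) (g : 'I_q -> T -> R) (bg : forall i, bounded_measurable (g i)).
Context (r : T -> R) (r0 : forall x, 0 <= r x).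
Context (ir : mu.-integrable setT (EFin \o r)).

Let mr : measurable_fun setT r.
Proof. exact/measurable_EFinP/(measurable_int _ ir). Qed.

(** Perturbations are sought as multiples of this bounded weight: it vanishes exactly where [r] does
    and lies below every truncation of [r] at a level [0 < n], so small multiples preserve both the
    sign and the zero set. *)
Let w x := Num.min (r x) 1.

Let bw : bounded_measurable w.
Proof. exact: bounded_measurable_minr. Qed.

Let ib f : bounded_measurable f -> mu.-integrable setT (EFin \o f).
Proof. exact: bounded_measurable_integrable. Qed.

Let irn n : mu.-integrable setT (EFin \o (fun x => r x - Num.min (r x) n%:R)).
Proof.
have := integrableB measurableT ir (ib (bounded_measurable_minr n%:R mr r0)).
exact: eq_integrable.
Qed.

(** Gram matrix of the [g i] in L^2 of the measure with density [w]. Adding the combination of the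
    [g j] with coefficients [c], times [w], to a density changes its integrals against the [g i] by
    [c *m gram]. *)
Let gram : 'M[R]_q := \matrix_(i, j) \int[mu]_x (g i x * g j x * w x).

Let defect n : 'rV[R]_q :=
  \row_i \int[mu]_x (g i x * (r x - Num.min (r x) n%:R)).

Let bgg i j : bounded_measurable (fun x => g i x * g j x * w x).
Proof. by do 2 apply: bounded_measurableM => //. Qed.

(* A vector orthogonal to the rows of the Gram matrix gives a combination of
   the g_i that vanishes wherever r does not, hence is orthogonal to the defect
   too. *)
Let defect_sub n : (defect n <= gram)%MS.
Proof.
rewrite submxE; apply/eqP/rowP => k; rewrite mxE [RHS]mxE.
pose c i := cokermx gram i k; pose s x := \sum_i c i * g i x.
have bs : bounded_measurable s.
  by apply: bounded_measurable_sum => i; exact: bounded_measurableZ.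
have row0 i : \int[mu]_x (g i x * s x * w x) = 0.
  have /matrixP/(_ i k) := mulmx_coker gram; rewrite [LHS]mxE [RHS]mxE => <-.
  transitivity (\int[mu]_x \sum_j c j * (g i x * g j x * w x)).
    apply: eq_Rintegral => x _; rewrite /s mulr_sumr mulr_suml.
    by apply: eq_bigr => j _; ring.
  rewrite Rintegral_sum => [|j]; last exact/ib/bounded_measurableZ.
  apply: eq_bigr => j _; rewrite RintegralZl//; last exact: ib.
  by rewrite mulrC; congr (_ * _); rewrite mxE.
(* Being a combination of the [g i], [s] is orthogonal to itself as soon as it is orthogonal to each
   of them. *)
have ss0 : \int[mu]_x (s x * s x * w x) = 0.
  transitivity (\int[mu]_x \sum_j c j * (g j x * s x * w x)).
    apply: eq_Rintegral => x _; rewrite {1}/s 2!mulr_suml.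
    by apply: eq_bigr => j _; ring.
  rewrite Rintegral_sum => [|j]; last first.
    by apply/ib/bounded_measurableZ; do 2 apply: bounded_measurableM => //.
  rewrite big1// => j _; rewrite RintegralZl// ?row0 ?mulr0//.
  by apply: ib; do 2 apply: bounded_measurableM => //.
have bssw : bounded_measurable (fun x => s x * s x * w x).
  by do 2 apply: bounded_measurableM => //.
have N0 : mu [set x | s x * s x * w x != 0] = 0.
  apply: Rintegral_eq0 => //; first exact: ib.
  by move=> x; rewrite mulr_ge0 -?expr2 ?sqr_ge0// le_min r0 ler01.
transitivity (\int[mu]_x (s x * (r x - Num.min (r x) n%:R))).
  transitivity (\int[mu]_x \sum_j c j * (g j x * (r x - Num.min (r x) n%:R))).
    rewrite Rintegral_sum => [|j]; last first.
      have := bounded_measurable_integrableM (bounded_measurableZ (c j) (bg j)) (irn n).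
      by apply: eq_integrable => // x _ /=; rewrite -mulrA.
    apply: eq_bigr => j _; rewrite RintegralZl//; last first.
      exact: bounded_measurable_integrableM.
    by rewrite mulrC; congr (_ * _); rewrite mxE.
  by apply: eq_Rintegral => x _; rewrite mulr_suml; apply: eq_bigr => j _; ring.
rewrite (eq_Rintegral_null (h := cst 0) (N := [set x | s x * s x * w x != 0]))//.
- by rewrite Rintegral_cst// mul0r.
- have := emeasurable_neq measurableT (measurable_int _ (ib bssw)) 0%E.
  by rewrite setTI.
- apply: measurable_funM; first by case: bs.
  by apply: measurable_funB => //; exact: measurable_minr.
- move=> x /negP; rewrite negbK !mulf_eq0 orbb => /orP[/eqP ->|]; first by rewrite mul0r.
  rewrite /w minElt; case: ifPn => [_ /eqP ->|_]; last by rewrite oner_eq0.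
  by rewrite min_l ?subrr ?mulr0.
Qed.

(** The density is a truncation of [r] plus [p x * w x], where the coefficients of [p] solve
    [c *m gram = defect n]. For large [n] the defect is small, so that [|p x| <= 1/2] and the sum
    stays above [w x / 2]. *)
Lemma exists_bounded_density : exists h : T -> R, [/\ bounded_measurable h,
  (forall x, 0 <= h x), (forall x, h x = 0 <-> r x = 0) &
  forall i, \int[mu]_x (g i x * h x) = \int[mu]_x (g i x * r x)].
Proof.
have [B gB] : exists B, forall i x, `|g i x| <= B.
  have /choice[M gM] := fun i => (bg i).2.
  exists (\sum_i `|M i|) => i x; rewrite (le_trans (gM i x))// (le_trans (ler_norm _))//.
  by rewrite (bigD1 i)//= lerDl sumr_ge0.
pose D := \sum_j \sum_i `|pinvmx gram i j|.
have D0 : 0 <= D by apply: sumr_ge0 => j _; exact: sumr_ge0.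
pose t n := \int[mu]_x (r x - Num.min (r x) n%:R).
have t0 n : 0 <= t n.
  by apply: Rintegral_ge0 => x _; rewrite subr_ge0 ge_min lexx.
(* This product bounds [p]: [B * t n] bounds the entries of [defect n], [D] accounts for the
   pseudo-inverse, and the last [B] bounds the [g j]. *)
have [n [n1 tn]] : exists n, (0 < n)%N /\ B * t n * D * B <= 2^-1.
  have : B * t n * D * B @[n --> \oo] --> B * 0 * D * B.
    apply: cvgMl; apply: cvgMl; apply: cvgMr; exact: cvg_Rintegral_truncation.
  rewrite mulr0 !mul0r => /cvgr_lt -/(_ 2^-1); rewrite invr_gt0 ltr0n => /(_ isT) H.
  near \oo => n; exists n; split; first by near: n; exact: nbhs_infty_gt.
  by apply: ltW; near: n.
pose c := defect n *m pinvmx gram.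
have cgram : c *m gram = defect n by exact: mulmxKpV.
have defectB i : `|defect n ord0 i| <= B * t n.
  rewrite mxE (le_trans (le_normr_Rintegral _ _))//.
    exact: bounded_measurable_integrableM.
  rewrite -RintegralZl//; apply: le_Rintegral => //.
  - exact/integrable_norm/bounded_measurable_integrableM.
  - have := integrableZl measurableT B (irn n).
    by apply: eq_integrable => // x _ /=; rewrite EFinM.
  - move=> x _; rewrite normrM ler_pM//.
    by rewrite ger0_norm// subr_ge0 ge_min lexx.
pose p x := \sum_j c ord0 j * g j x.
have bp : bounded_measurable p.
  by apply: bounded_measurable_sum => j; exact: bounded_measurableZ.
have pB x : `|p x| <= 2^-1.
  apply: le_trans tn; rewrite (le_trans (ler_norm_sum _ _ _))//.
  rewrite /D mulr_sumr mulr_suml; apply: ler_sum => j _.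
  rewrite normrM ler_pM// mxE (le_trans (ler_norm_sum _ _ _))// mulr_sumr.
  by apply: ler_sum => i _; rewrite normrM ler_pM.
have w0 x : 0 <= w x by rewrite le_min r0 ler01.
have wn x : w x <= Num.min (r x) n%:R.
  by rewrite le_min !ge_min lexx/= ler1n n1 orbT.
pose h x := Num.min (r x) n%:R + p x * w x.
have hw x : w x / 2 <= h x.
  have : - (2^-1 * w x) <= p x * w x.
    by rewrite -mulNr ler_wpM2r//; move: (pB x); rewrite ler_norml => /andP[].
  have := wn x; rewrite /h; lra.
have bm : bounded_measurable (fun x => Num.min (r x) n%:R).
  exact: bounded_measurable_minr.
exists h; split.
- by apply: bounded_measurableD => //; exact: bounded_measurableM.
- by move=> x; apply: le_trans (hw x); rewrite divr_ge0.
- move=> x; split => [hx0|rx0]; last first.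
    by rewrite /h /w rx0 !min_l ?ler0n ?mulr0 ?addr0.
  have := hw x; rewrite hx0 pmulr_lle0 ?invr_gt0// => wx0.
  have : w x = 0 by apply/eqP; rewrite eq_le wx0 w0.
  by rewrite /w minElt; case: ifPn => // _ /eqP; rewrite oner_eq0.
- move=> i.
  have igr : mu.-integrable setT (EFin \o (fun x => g i x * r x)).
    exact: bounded_measurable_integrableM.
  transitivity (\int[mu]_x (g i x * Num.min (r x) n%:R) + defect n ord0 i).
    transitivity (\int[mu]_x (g i x * Num.min (r x) n%:R) +
        \int[mu]_x \sum_j c ord0 j * (g j x * g i x * w x)).
      rewrite -RintegralD//; first last.
      - apply: ib; apply: bounded_measurable_sum => j; exact: bounded_measurableZ.
      - by apply: ib; exact: bounded_measurableM.
      apply: eq_Rintegral => x _; rewrite /h mulrDr /p; congr (_ + _).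
      by rewrite mulrCA mulr_suml; apply: eq_bigr => j _; ring.
    congr (_ + _); rewrite -cgram mxE Rintegral_sum => [|j]; last first.
      exact/ib/bounded_measurableZ.
    by apply: eq_bigr => j _; rewrite RintegralZl ?mxE//; exact: ib.
  rewrite mxE -RintegralD//; first last.
  - exact: bounded_measurable_integrableM.
  - by apply: ib; exact: bounded_measurableM.
  by apply: eq_Rintegral => x _; ring.
Unshelve. all: by end_near. Qed.

End bounded_density.

(** * Densities of the iterates *)

Section em_iteration.
Context d (T : measurableType d) (R : realType).
Context (mu : {finite_measure set T -> \bar R}).
Context (I : finType) (f : T -> R) (g : I -> T -> R) (c : R).
Hypotheses (bf : bounded_measurable f) (bg : forall i, bounded_measurable (g i)).
Hypotheses (g0 : forall i x, 0 <= g i x) (c0 : 0 < c).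
Hypotheses (fc : forall x, f x = 0 \/ c <= f x).
Hypotheses (gf0 : forall i x, f x = 0 -> g i x = 0).

Let ib k : bounded_measurable k -> mu.-integrable setT (EFin \o k).
Proof. exact: bounded_measurable_integrable. Qed.

Let f0 x : 0 <= f x.
Proof. by case: (fc x) => [->//|]; apply: le_trans; exact: ltW. Qed.

Definition em_factor (u : I -> R) x := (f x)^-1 * \sum_i g i x / u i.

Fixpoint em_density (u : nat -> I -> R) k x :=
  if k is k'.+1 then em_density u k' x * em_factor (u k') x else 1.

Lemma bounded_measurable_em_factor u : bounded_measurable (em_factor u).
Proof.
apply: bounded_measurableM; first exact: (bounded_measurableV bf c0).
apply: bounded_measurable_sum => i.
by apply: bounded_measurableM => //; exact: bounded_measurable_cst.
Qed.

Lemma em_factor_ge0 u x : (forall i, 0 < u i) -> 0 <= em_factor u x.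
Proof.
move=> u0; rewrite mulr_ge0 ?invr_ge0//; apply: sumr_ge0 => i _.
by rewrite divr_ge0// ltW.
Qed.

Lemma bounded_measurable_em_density u k : bounded_measurable (em_density u k).
Proof.
elim: k => [|k IHk] /=; first exact: bounded_measurable_cst.
by apply: bounded_measurableM => //; exact: bounded_measurable_em_factor.
Qed.

Lemma em_density_ge0 u k x : (forall k i, 0 < u k i) -> 0 <= em_density u k x.
Proof.
by move=> u0; elim: k => //= k IHk; rewrite mulr_ge0// em_factor_ge0.
Qed.

(** The factor [f] cancels the [(f x)^-1] of the update and each index contributes [u i / u i = 1];
    where [f] vanishes, so do the [g i]. *)
Lemma em_mass (G : T -> R) (u : I -> R) : bounded_measurable G ->
  (forall i, 0 < u i) -> (forall i, u i = \int[mu]_x (g i x * G x)) ->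
  \int[mu]_x (f x * (G x * em_factor u x)) = #|I|%:R.
Proof.
move=> bG u0 uE; transitivity (\int[mu]_x \sum_i (u i)^-1 * (g i x * G x)).
  apply: eq_Rintegral => x _; rewrite /em_factor mulrCA.
  have [fx|fx] := eqVneq (f x) 0.
    by rewrite fx mul0r mulr0 big1// => i _; rewrite gf0// mul0r mulr0.
  rewrite mulVKf// mulr_sumr; apply: eq_bigr => i _.
  by ring.
rewrite Rintegral_sum => [|i]; last first.
  by apply/ib/bounded_measurableZ; exact: bounded_measurableM.
rewrite (eq_bigr (fun=> 1)) ?sumr_const// => i _; rewrite RintegralZl//.
  by rewrite -uE mulVf// gt_eqF.
by apply: ib; exact: bounded_measurableM.
Qed.

(** Wherever the update factor vanishes, every [g i] vanishes, so multiplying by it creates no new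
    zeros of [g i x * G x]; a zero integral after the update would force a zero integral before. *)
Lemma em_pos (G : T -> R) (u : I -> R) i : bounded_measurable G ->
  (forall x, 0 <= G x) -> (forall i, 0 < u i) ->
  0 < \int[mu]_x (g i x * G x) ->
  0 < \int[mu]_x (g i x * (G x * em_factor u x)).
Proof.
move=> bG G0 u0 gG; pose p x := g i x * (G x * em_factor u x).
have bp : bounded_measurable p.
  by do 2 (apply: bounded_measurableM => //); exact: bounded_measurable_em_factor.
have p0 x : 0 <= p x by rewrite mulr_ge0// mulr_ge0// em_factor_ge0.
rewrite lt0r; apply/andP; split; last by apply: Rintegral_ge0 => x _; exact: p0.
apply: contraPneq gG => p_int0.
have N0 := Rintegral_eq0 (ib bp) p0 p_int0.
apply/negP; rewrite -leNgt.
rewrite (eq_Rintegral_null (h := cst 0) (N := [set x | p x != 0]))//.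
- by rewrite Rintegral_cst// mul0r.
- have := emeasurable_neq measurableT (measurable_int _ (ib bp)) 0%E.
  by rewrite setTI.
- by have [] := bounded_measurableM (bg i) bG.
move=> x /negP; rewrite negbK /p !mulf_eq0 => /or3P[/eqP ->|/eqP ->|].
- by rewrite mul0r.
- by rewrite mulr0.
rewrite invr_eq0 => /orP[/eqP fx|].
  by rewrite gf0// mul0r.
rewrite psumr_eq0 => [/allP/(_ i)|j _]; last by rewrite divr_ge0// ltW.
rewrite mem_index_enum => /(_ isT)/=.
by rewrite mulf_eq0 invr_eq0 (gt_eqF (u0 i)) orbF => /eqP ->; rewrite mul0r.
Qed.

Context (u : nat -> I -> R) (v : I -> R).
Hypotheses (u0 : forall k i, 0 < u k i) (v0 : forall i, 0 < v i).

(** Induction on [N]: the new factor is [f^-1] times the sum of the values [v i / u N i] with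
    weights [g i x / v i], and Jensen bounds its logarithm from below. *)
Lemma em_log_density N x : 0 < f x -> \sum_i g i x / v i = f x ->
  0 < em_density u N x /\
  \sum_i g i x / v i * (\sum_(k < N) ln (v i / u k i)) <= f x * ln (em_density u N x).
Proof.
move=> fx0 gvf; elim: N => [|N [G0 IHN]] /=.
  by rewrite ln1 mulr0 big1// => i _; rewrite big_ord0 mulr0.
have [||S0 jensen] := @weighted_jensen_ln _ _ (fun i => g i x / v i)
    (fun i => v i / u N i) (f x) _ _ gvf fx0.
- by move=> i; rewrite divr_ge0// ltW.
- by move=> i; rewrite divr_gt0.
have vu : \sum_i g i x / v i * (v i / u N i) = \sum_i g i x / u N i.
  by apply: eq_bigr => i _; rewrite mulrA divfK// gt_eqF.
rewrite vu -/(em_factor (u N) x) in S0 jensen.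
have F0 : 0 < em_factor (u N) x by rewrite mulr_gt0// invr_gt0.
split; first exact: mulr_gt0.
rewrite lnM ?posrE// mulrDr; apply: le_trans (lerD IHN jensen).
rewrite -big_split le_eqVlt; apply/orP; left; apply/eqP; apply: eq_bigr => i _ /=.
by rewrite big_ord_recr/= mulrDr.
Qed.

Context (h : T -> R) (M : R) (bh : bounded_measurable h).
Hypotheses (h0 : forall x, 0 <= h x) (hM : forall x, h x <= M).
Hypotheses (hopt : forall x, h x != 0 -> \sum_i g i x / v i = f x).
Hypotheses (hv : forall i, \int[mu]_x (g i x * h x) = v i).

Let em_log_density_tangent N x s : 0 < s ->
  h x * (\sum_i g i x / v i * (\sum_(k < N) ln (v i / u k i))) <=
  h x * (f x * (em_density u N x / s + ln s - 1)).
Proof.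
move=> s0; have [->|hx] := eqVneq (h x) 0; first by rewrite !mul0r.
rewrite ler_wpM2l//; have [fx|fx] := eqVneq (f x) 0.
  by rewrite fx mul0r big1// => i _; rewrite gf0// !mul0r.
have fx0 : 0 < f x by rewrite lt0r fx f0.
have [G0 /le_trans] := em_log_density N fx0 (hopt hx); apply.
by rewrite ler_wpM2l// ln_le_tangent.
Qed.

(* The tangent bound for ln is used at the point s on V and at 1 off V. *)
Lemma sum_log_likelihood_ratio_le N (V : set T) (phi : T -> R) s :
  measurable V -> bounded_measurable phi -> (forall x, \1_V x <= phi x) ->
  0 < s <= 1 ->
  \sum_(k < N) \sum_i ln (v i / u k i) <=
  M * (\int[mu]_x (f x * em_density u N x)) +
  M / s * (\int[mu]_x (phi x * (f x * em_density u N x))) +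
  ln s * \int[mu]_x (\1_V x * (f x * h x)).
Proof.
move=> mV bphi Vphi /andP[s0 s1].
have bG : bounded_measurable (em_density u N) by exact: bounded_measurable_em_density.
have bfG : bounded_measurable (fun x => f x * em_density u N x) by exact: bounded_measurableM.
have bpfG : bounded_measurable (fun x => phi x * (f x * em_density u N x)).
  exact: bounded_measurableM.
have bVfh : bounded_measurable (fun x => \1_V x * (f x * h x)).
  by apply: bounded_measurableM; [exact: bounded_measurable_indic|exact: bounded_measurableM].
have bgh i : bounded_measurable (fun x => g i x * h x) by exact: bounded_measurableM.
pose L i := \sum_(k < N) ln (v i / u k i).
(* Since [g i x * h x] integrates to [v i], integration against [h] cancels the divisions by [v i],
   and the bound can be proved pointwise. *)
have -> : \sum_(k < N) \sum_i ln (v i / u k i) =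
    \int[mu]_x \sum_i L i / v i * (g i x * h x).
  rewrite exchange_big Rintegral_sum => [|i]; last exact/ib/bounded_measurableZ.
  apply: eq_bigr => i _.
  by rewrite RintegralZl ?hv ?divfK// ?gt_eqF//; exact: ib.
rewrite -!RintegralZl//; try exact: ib.
rewrite -!RintegralD//; try (apply: ib; repeat apply: bounded_measurableD;
  exact: bounded_measurableZ).
apply: le_Rintegral => //.
- apply: ib; apply: bounded_measurable_sum => i; exact: bounded_measurableZ.
- by apply: ib; repeat apply: bounded_measurableD; exact: bounded_measurableZ.
move=> x _.
have fG0 : 0 <= f x * em_density u N x by rewrite mulr_ge0// em_density_ge0.
have M0 : 0 <= M by rewrite (le_trans (h0 x)).
have -> : \sum_i L i / v i * (g i x * h x) = h x * \sum_i g i x / v i * L i.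
  by rewrite mulr_sumr; apply: eq_bigr => i _; ring.
have hfG t : 0 < t -> h x * (f x * (em_density u N x / t)) <=
    M * (f x * em_density u N x) / t.
  move=> t0; rewrite (_ : h x * _ = h x * (f x * em_density u N x) / t); last by ring.
  by rewrite ler_pM2r ?invr_gt0// ler_wpM2r.
have [xV|xV] := boolP (x \in V).
  have phi1 : 1 <= phi x by rewrite (le_trans _ (Vphi x))// indicE xV.
  apply: le_trans (em_log_density_tangent N x s0) _; rewrite indicE xV mul1r.
  have := hfG _ s0.
  have : M * (f x * em_density u N x) / s <=
      M / s * (phi x * (f x * em_density u N x)).
    rewrite mulrAC ler_wpM2l ?divr_ge0 ?(ltW s0)//.
    by rewrite -[leLHS]mul1r ler_wpM2r.
  have : 0 <= M * (f x * em_density u N x) by rewrite mulr_ge0.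
  have : 0 <= h x * f x by rewrite mulr_ge0.
  lra.
have phi0 : 0 <= phi x by rewrite (le_trans _ (Vphi x))// indicE ler0n.
apply: le_trans (em_log_density_tangent N x ltr01) _.
rewrite indicE (negbTE xV) mul0r mulr0 addr0 ln1 addr0 divr1.
have := hfG _ ltr01; rewrite !divr1 => hfG1.
have : 0 <= M / s * (phi x * (f x * em_density u N x)).
  by rewrite !mulr_ge0// ?invr_ge0 ?(ltW s0)//; exact: em_density_ge0.
have : 0 <= h x * f x by rewrite mulr_ge0.
lra.
Qed.

End em_iteration.

(** * Radon measures on K *)

Section radon_toolkit.
Context (R : realType) (p : nat) (K : set 'rV[R]_p).
Implicit Types (mu nu : radon K) (g : K -> R) (A : set 'rV[R]_p).

Lemma valL0_val g (x : K) : valL_ 0 g (\val x) = g x.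
Proof. by rewrite /valL_/= oinv_set_val valK. Qed.

Lemma valL0_notin g y : ~ K y -> valL_ 0 g y = 0.
Proof. by move=> Ky; rewrite /valL_/= oinv_set_val insubN// notin_setE. Qed.

Lemma valL0_ind g (P : 'rV[R]_p -> R -> Prop) :
  (forall x : K, P (\val x) (g x)) -> (forall y, ~ K y -> P y 0) ->
  forall y, P y (valL_ 0 g y).
Proof.
move=> PK PN y; have [Ky|Ky] := pselect (K y); last by rewrite valL0_notin//; exact: PN.
by have := PK (SigSub (mem_set Ky)); rewrite -(valL0_val g).
Qed.

Definition radon_pos mu : {finite_measure set 'rV[R]_p -> \bar R} :=
  jordan_pos (svalP (hahn_sets mu)).
Definition radon_neg mu : {finite_measure set 'rV[R]_p -> \bar R} :=
  jordan_neg (svalP (hahn_sets mu)).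

Lemma radon_jordan mu A : measurable A -> (mu A = radon_pos mu A - radon_neg mu A)%E.
Proof.
by move=> mA; rewrite (jordan_decomp (svalP (hahn_sets mu)) mA)/cadd/= cscaleN1.
Qed.

Lemma radon_pos_restrict mu : exists2 D, measurable D &
  forall A, measurable A -> radon_pos mu A = mu (A `&` D).
Proof.
have [[mP _] _ _ _] := svalP (hahn_sets mu); exists (sval (hahn_sets mu)).1 => // A mA.
transitivity (jordan_pos (svalP (hahn_sets mu)) A); first by [].
by rewrite jordan_posE cjordan_posE /crestr0 mem_set.
Qed.

Lemma radon_neg_restrict mu : exists2 D, measurable D /\
    (forall A, measurable A -> (mu (A `&` D) <= 0)%E) &
  forall A, measurable A -> (radon_neg mu A = - mu (A `&` D))%E.
Proof.
have [_ [mN N0] _ _] := svalP (hahn_sets mu); exists (sval (hahn_sets mu)).2.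
  by split => // A mA; apply: N0; [exact: measurableI|exact: subIsetr].
move=> A mA; transitivity (jordan_neg (svalP (hahn_sets mu)) A); first by [].
by rewrite jordan_negE cjordan_negE /crestr0 mem_set.
Qed.

Lemma radon_nonneg_pos mu A : radon_nonneg mu -> measurable A ->
  radon_pos mu A = mu A.
Proof.
move=> mu0 mA; have [D [mD D0] negE] := radon_neg_restrict mu.
rewrite (radon_jordan _ mA) negE// (_ : mu (A `&` D) = 0%E) ?oppe0 ?adde0//.
by apply/eqP; rewrite eq_le; apply/andP; split; [exact: D0|exact/mu0/measurableI].
Qed.

Lemma radon_nonneg_neg mu A : radon_nonneg mu -> measurable A ->
  radon_neg mu A = 0%E.
Proof.
move=> mu0 mA; have [D [mD D0] negE] := radon_neg_restrict mu.
rewrite negE// (_ : mu (A `&` D) = 0%E) ?oppe0//.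
by apply/eqP; rewrite eq_le; apply/andP; split; [exact: D0|exact/mu0/measurableI].
Qed.

Lemma Rintegral_valL0 (mu : {measure set 'rV[R]_p -> \bar R}) g :
  \int[mu]_(x in K) valL_ 0 g x = \int[mu]_x valL_ 0 g x.
Proof.
rewrite Rintegral_mkcond; apply: eq_Rintegral => x _.
by rewrite /patch; case: ifPn => //; rewrite notin_setE => /valL0_notin ->.
Qed.

Lemma pairingE mu g : pairing mu g =
  \int[radon_pos mu]_x valL_ 0 g x - \int[radon_neg mu]_x valL_ 0 g x.
Proof. by rewrite /pairing /radon_int !Rintegral_valL0. Qed.

Lemma radon_int_nonneg mu A g : radon_nonneg mu -> measurable A ->
  radon_int mu A g = \int[radon_pos mu]_(x in A) valL_ 0 g x.
Proof.
move=> mu0 mA; rewrite /radon_int [X in _ - X](_ : _ = 0) ?subr0//.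
rewrite /Rintegral (eq_measure_integral mzero) ?integral_measure_zero// => B mB _.
exact: radon_nonneg_neg.
Qed.

Lemma pairing_nonneg mu g : radon_nonneg mu -> measurable K ->
  pairing mu g = \int[radon_pos mu]_x valL_ 0 g x.
Proof. by move=> mu0 mK; rewrite /pairing radon_int_nonneg// Rintegral_valL0. Qed.

Section density.
Context (P : {finite_measure set 'rV[R]_p -> \bar R}) (h : 'rV[R]_p -> R).
Hypotheses (PK : forall A, measurable A -> A `&` K = set0 -> P A = 0%E).
Hypotheses (ih : P.-integrable setT (EFin \o h)) (h0 : forall x, 0 <= h x).

Let density_carried A : measurable A -> A `&` K = set0 -> induced_charge ih A = 0%E.
Proof.
move=> mA AK; rewrite /induced_charge null_set_integral//; last exact: PK.
by apply: measurable_funTS; exact: measurable_int ih.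
Qed.

Definition density_radon : radon K := Radon density_carried.

Lemma density_radon_nonneg : radon_nonneg density_radon.
Proof. by move=> A mA; apply: integral_ge0 => x _; rewrite lee_fin. Qed.

End density.

Lemma pairing_density (P : {finite_measure set 'rV[R]_p -> \bar R})
    (h : 'rV[R]_p -> R) mu g : measurable K ->
  radon_nonneg mu -> (forall x, 0 <= h x) -> P.-integrable setT (EFin \o h) ->
  (forall A, measurable A -> mu A = \int[P]_(x in A) (h x)%:E)%E ->
  bounded_measurable (valL_ 0 g) ->
  pairing mu g = \int[P]_x (valL_ 0 g x * h x).
Proof.
move=> mK mu0 h0 ih muh bg; rewrite pairing_nonneg//.
by apply: Rintegral_density => // A mA; rewrite radon_nonneg_pos// muh.
Qed.

(** The extension by zero need not be continuous. The preimage of an open interval is the trace on K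
    of an open set, together with the complement of K when the interval contains 0; boundedness
    comes from the compact image of K. *)
Lemma bounded_measurable_valL0 g : compact K -> continuous g ->
  bounded_measurable (valL_ 0 g).
Proof.
move=> cK cg; split.
  apply: (measurability _ (RGenOpens.measurableE R)).
  move=> _ [_ [a [b ->] <-]]; rewrite setTI.
  have [U oU Ug] : open (g @^-1` `]a, b[%classic).
    by move/continuousP : cg; apply; exact: interval_open.
  have mK : measurable K by apply: closed_measurable_mx; exact: compact_closed.
  set J := [set` _] in Ug *.
  rewrite (_ : _ @^-1` _ = (U `&` K) `|` (if `[< J 0 >] then ~` K else set0)).
    apply: measurableU; first by apply: measurableI => //; exact: open_measurable_mx.
    by case: ifPn => // _; exact: measurableC.
  apply/seteqP; split => [|y [[Uy Ky]|]].
  - apply: (valL0_ind (P := fun y z => J z ->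
        ((U `&` K) `|` (if `[< J 0 >] then ~` K else set0)) y)) => [x|y Ky] Jz.
      have : (g @^-1` J) x by [].
      by rewrite -Ug => Ux; left; split => //; exact/set_mem/valP.
    by right; rewrite asboolT.
  - pose x : K := SigSub (mem_set Ky).
    have : (set_val @^-1` U) x by [].
    by rewrite Ug => Jx; change (J (valL_ 0 g (\val x))); rewrite valL0_val.
  - case: ifPn => // /asboolP J0 Ky.
    by change (J (valL_ 0 g y)); rewrite valL0_notin.
have : compact (valL_ 0 g @` K).
  by apply: continuous_compact cK; exact/subspace_valL_continuousP'.
move=> /compact_bounded[M [Mr gM]].
exists (`|M| + 1).
apply: (valL0_ind (P := fun _ z => `|z| <= `|M| + 1)) => [x|y _].
  apply: gM; first by rewrite (le_lt_trans (ler_norm _))// ltrDl.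
  by exists (\val x); [exact/set_mem/valP|rewrite valL0_val].
by rewrite normr0 addr_ge0.
Qed.

End radon_toolkit.

(** * Supports and weak-* limit points *)

(** The function is the distance to the complement of [O], capped at 1; an empty complement is
    treated apart, the infimum then being over the empty set. *)
Lemma open_cozero (R : realType) (V : normedModType R) (O : set V) : open O ->
  exists psi : V -> R, [/\ continuous psi, forall x, 0 <= psi x <= 1 &
    forall x, O x <-> 0 < psi x].
Proof.
move=> oO; have [CO0|/set0P[z0 Cz0]] := eqVneq (~` O) set0.
  exists (cst 1); split => [|x|x]; first exact: cst_continuous.
    by rewrite ler01 lexx.
  by split => // _; apply: contrapT => Ox; have : (~` O) x by []; rewrite CO0.
pose D x := [set `|x - z| | z in ~` O]; pose dist x := inf (D x).
have D0 x : D x !=set0 by exists `|x - z0|, z0.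
have Dlb x : lbound (D x) 0 by move=> _ [z _ <-].
have dist_le x z : ~ O z -> dist x <= `|x - z|.
  by move=> Oz; apply: ge_inf; [exists 0|exists z].
have lip x y : dist x <= `|x - y| + dist y.
  rewrite -lerBlDl; apply: lb_le_inf => // _ [z Oz <-].
  by rewrite lerBlDl (le_trans (dist_le x z Oz))// ler_distD.
have dist0 x : 0 <= dist x by exact: lb_le_inf.
have cdist : continuous dist.
  move=> x; apply/cvgrPdist_lt => e e0; near=> y.
  apply: (@le_lt_trans _ _ `|x - y|).
    by rewrite ler_norml lerBlDr lip andbT lerNl opprB lerBlDr distrC lip.
  by near: y; apply: cvgr_dist_lt.
exists (fun x => Num.min (dist x) 1); split => [x|x|x].
- by apply: continuous_min; [exact: cdist|exact: cvg_cst].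
- by rewrite le_min dist0 ler01 ge_min lexx orbT.
- split => [Ox|]; last first.
    rewrite lt_min ltr01 andbT; apply: contraPP => Ox; apply/negP.
    by rewrite -leNgt (le_trans (dist_le x x Ox))// subrr normr0.
  have /nbhs_ballP[e /= e0 eO] : nbhs x O by exact: open_nbhs_nbhs.
  rewrite lt_min ltr01 andbT (lt_le_trans e0)//; apply: lb_le_inf => // _ [z Oz <-].
  rewrite leNgt; apply/negP => xz; apply: Oz; apply: eO.
  by rewrite -ball_normE.
Unshelve. all: by end_near. Qed.

Section support.
Context (R : realType) (p : nat) (K : set 'rV[R]_p) (cK : compact K).
Implicit Types (mu nu : radon K) (A U : set 'rV[R]_p).

Lemma restriction_continuous (psi : 'rV[R]_p -> R) : continuous psi ->
  continuous ((fun x => psi (\val x)) : K -> R).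
Proof.
move=> cpsi x; apply: (@continuous_comp _ _ _ (set_val : K -> _) psi); last exact: cpsi.
exact: initial_continuous.
Qed.

(** The weak-* neighborhood given by the single function [g] meets every tail of the sequence. No
    subsequence is extracted: one late index is enough for the support arguments. *)
Lemma cluster_pairing (mu : nat -> radon K) mubar (g : continuousType K R) (e : R) N :
  cluster (mu k @[k --> \oo]) mubar -> 0 < e ->
  exists2 k, (N <= k)%N & `|pairing (mu k) g - pairing mubar g| < e.
Proof.
move=> cmu e0.
have /(weak_star_cvgP _ _) H : nbhs mubar --> mubar by [].
have /cvgrPdist_lt/(_ e e0) {}H := H g.
have [|nu [[k Nk <-] nue]] := cmu [set mu k | k in [set k | (N <= k)%N]] _ _ H.
  apply: (filterS _ (nbhs_infty_ge N)) => k /= Nk; exact: imageP.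
by exists k => //; rewrite distrC.
Qed.

Let mK : measurable K.
Proof. by apply: closed_measurable_mx; exact: compact_closed. Qed.

Lemma radon_pos_null mu A : measurable A ->
  (forall B, measurable B -> B `<=` A -> mu B = 0%E) -> radon_pos mu A = 0%E.
Proof.
move=> mA A0; have [D mD ->//] := radon_pos_restrict mu.
by apply: A0; [exact: measurableI|exact: subIsetl].
Qed.

Lemma radon_neg_null mu A : measurable A ->
  (forall B, measurable B -> B `<=` A -> mu B = 0%E) -> radon_neg mu A = 0%E.
Proof.
move=> mA A0; have [D [mD _] ->//] := radon_neg_restrict mu.
by rewrite A0 ?oppe0//; exact: measurableI.
Qed.

Lemma radon_null_off mu B : measurable B -> B `<=` ~` K -> mu B = 0%E.
Proof.
move=> mB BK; apply: radon_carried => //.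
by apply/seteqP; split => // x [/BK].
Qed.

Lemma pairing_null mu U (g : continuousType K R) : measurable U ->
  (forall B, measurable B -> B `<=` U -> mu B = 0%E) ->
  (forall x : K, ~ U (\val x) -> g x = 0) -> pairing mu g = 0.
Proof.
move=> mU U0 gU; rewrite pairingE.
have bg : bounded_measurable (valL_ 0 g).
  by apply: bounded_measurable_valL0 => //; exact: cts_fun.
have gU' y : ~ U y -> valL_ 0 g y = 0.
  by apply: (valL0_ind (P := fun y z => ~ U y -> z = 0)).
have int0 (P : {measure set 'rV[R]_p -> \bar R}) : P U = 0%E ->
    \int[P]_x valL_ 0 g x = 0.
  move=> PU; rewrite (@eq_Rintegral_null _ _ _ P _ (cst 0) U)//.
    by rewrite Rintegral_cst// mul0r.
  by case: bg.
by rewrite !int0 ?subrr//; [exact: radon_neg_null|exact: radon_pos_null].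
Qed.

(** The two Jordan parts, restricted to [U], agree on open sets, a family stable under intersection
    that generates the Borel sets; hence they agree on every Borel set. *)
Lemma pairing_eq0_null mu U : open U ->
  (forall psi : 'rV[R]_p -> R, forall cpsi : continuous psi,
    (forall x, ~ U x -> psi x = 0) -> (forall x, 0 <= psi x <= 1) ->
    pairing mu (fun x : K => psi (\val x)) = 0) ->
  forall A, measurable A -> A `<=` U -> mu A = 0%E.
Proof.
move=> oU H; have mU : measurable U by exact: open_measurable_mx.
have posK A : measurable A -> A `<=` ~` K -> radon_pos mu A = 0%E.
  move=> mA AK; apply: radon_pos_null => // B mB BA; apply: radon_null_off => //.
  exact: subset_trans AK.
have negK A : measurable A -> A `<=` ~` K -> radon_neg mu A = 0%E.
  move=> mA AK; apply: radon_neg_null => // B mB BA; apply: radon_null_off => //.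
  exact: subset_trans AK.
(* The indicator of O is the limit of continuous functions vanishing off O. *)
have eq_open O : open O -> O `<=` U -> radon_pos mu O = radon_neg mu O.
  move=> oO OU; have [psi [cpsi psi01 psiO]] := open_cozero oO.
  have mO : measurable O by exact: open_measurable_mx.
  pose psin n x := Num.min (n%:R * psi x) 1.
  have cpsin n : continuous (psin n).
    move=> x; apply: (@continuous_min _ _ (fun y => n%:R * psi y) (cst 1)).
      by apply: cvgMr; [exact: nbhs_filter|exact: cpsi].
    by apply: cvg_cst; exact: nbhs_filter.
  have psin01 n x : 0 <= psin n x <= 1.
    by rewrite le_min ge_min lexx orbT ler01 mulr_ge0//; case/andP: (psi01 x).
  have psinO n x : ~ O x -> psin n x = 0.
    move=> Ox; have psix : psi x = 0.
      apply/eqP; rewrite eq_le; have /andP[psi0 _] := psi01 x.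
      by rewrite psi0 andbT leNgt; apply/negP => /psiO.
    by rewrite /psin psix mulr0 min_l.
  pose gn n := valL_ 0 (fun x : K => psin n (\val x)).
  have bgn n : bounded_measurable (gn n).
    by apply: bounded_measurable_valL0 => //; exact: restriction_continuous.
  have lim_gn (P : {finite_measure set 'rV[R]_p -> \bar R}) :
      (\int[P]_x (gn n x)%:E @[n --> \oo] --> P (O `&` K))%E.
    have mOK : measurable (O `&` K) by exact: measurableI.
    have [|||||_ _] := @dominated_convergence _ _ _ P setT measurableT
      (fun n x => (gn n x)%:E) (fun x => (\1_(O `&` K) x)%:E) (cst 1%E).
    - by move=> n; apply/measurable_EFinP; case: (bgn n).
    - exact/measurable_EFinP/measurable_indic.
    - apply: aeW => x _; have [Kx|Kx] := pselect (K x); last first.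
        rewrite indicE memNset; last by case.
        by apply: cvg_near_cst; apply: nearW => n; rewrite /gn valL0_notin.
      have gnE n : gn n x = psin n x.
        exact: (valL0_val (fun x : K => psin n (\val x)) (SigSub (mem_set Kx))).
      have [Ox|Ox] := pselect (O x); last first.
        rewrite indicE memNset; last by case.
        by apply: cvg_near_cst; apply: nearW => n; rewrite gnE psinO.
      rewrite indicE mem_set//; apply: cvg_near_cst; near=> n; rewrite gnE.
      rewrite /psin min_r// -ler_pdivrMr; last exact/psiO.
      by near: n; exact: nbhs_infty_ger.
    - exact: finite_measure_integrable_cst.
    - apply: aeW => x n _; rewrite /= lee_fin.
      apply: (valL0_ind (P := fun _ z => `|z| <= 1)) => [{}x|_ _]; last by rewrite normr0.
      by have /andP[? ?] := psin01 n (\val x); rewrite ger0_norm.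
    by rewrite integral_indic// setIT.
  have pos_neg n : (\int[radon_pos mu]_x (gn n x)%:E = \int[radon_neg mu]_x (gn n x)%:E)%E.
    have ifin (P : {finite_measure set 'rV[R]_p -> \bar R}) :
        (\int[P]_x (gn n x)%:E)%E \is a fin_num.
      by apply: integrable_fin_num => //; exact: bounded_measurable_integrable.
    rewrite -[LHS]fineK ?ifin// -[RHS]fineK ?ifin//; congr EFin; apply/eqP.
    have := H (psin n) (cpsin n); rewrite pairingE => /(_ _ (psin01 n)) H0.
    by rewrite -subr_eq0; apply/eqP/H0 => x Ux; apply: psinO => /OU.
  have : radon_pos mu (O `&` K) = radon_neg mu (O `&` K).
    have := lim_gn (radon_pos mu); under eq_fun do rewrite pos_neg.
    by move=> /cvg_unique; apply; [exact: ereal_hausdorff|exact: lim_gn].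
  (* The limit only concerns the trace of [O] on K; the remainder of [O] is null for both parts,
     which are carried by K. *)
  have split_K (P : {finite_measure set 'rV[R]_p -> \bar R}) :
      (forall A, measurable A -> A `<=` ~` K -> P A = 0%E) -> P O = P (O `&` K).
    move=> PK; rewrite -{1}(setUIDK O K) measureU//; last 3 first.
    - exact: measurableI.
    - exact: measurableD.
    - by rewrite setDE setIACA setICr setI0.
    by rewrite [X in (_ + X)%E]PK ?adde0//; exact: measurableD.
  by rewrite (split_K (radon_pos mu))// (split_K (radon_neg mu)).
pose P : {measure set 'rV[R]_p -> \bar R} := mrestr (radon_pos mu) mU.
pose N : {measure set 'rV[R]_p -> \bar R} := mrestr (radon_neg mu) mU.
have eqPN A : measurable A -> P A = N A.
  move=> mA; apply: (@g_sigma_algebra_measure_unique _ R 'rV[R]_p (@open 'rV[R]_p) _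
    (fun=> setT) _ _ P N).
  - exact: open_measurable_mx.
  - by move=> _; exact: openT.
  - by rewrite bigcup_const.
  - by move=> B C oB oC; exact: openI.
  - by move=> B oB; apply: eq_open; [exact: openI|exact: subIsetr].
  - by move=> _; rewrite /P/= /mrestr setTI ltey_eq fin_num_measure.
  - exact: mA.
move=> A mA AU; rewrite radon_jordan//.
have := eqPN A mA; rewrite /P /N /= /mrestr (setIidl AU) => ->.
by rewrite subee// fin_num_measure.
Unshelve. all: by end_near. Qed.

End support.

(** * First-order optimality *)

Section radon_optimality.
Context (R : realType) (p : nat) (K : set 'rV[R]_p) (cK : compact K).

Let mK : measurable K.
Proof. by apply: closed_measurable_mx; exact: compact_closed. Qed.

Let bm (g : continuousType K R) : bounded_measurable (valL_ 0 g).
Proof. by apply: bounded_measurable_valL0 => //; exact: cts_fun. Qed.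

Lemma radon_pos_carried (mu : radon K) A : measurable A -> A `&` K = set0 ->
  radon_pos mu A = 0%E.
Proof.
move=> mA AK; apply: radon_pos_null => // B mB BA; apply: radon_carried => //.
by apply/seteqP; split => // x [/BA Ax Kx]; rewrite -AK.
Qed.

(** Point evaluation is a pairing, so pointwise signs can be read off from pairings with nonnegative
    measures. *)
Lemma pairing_dirac (x : K) : exists2 mu : radon K, radon_nonneg mu &
  forall g : continuousType K R, pairing mu g = g x.
Proof.
pose P : {finite_measure set 'rV[R]_p -> \bar R} := \d_(\val x).
have PK A : measurable A -> A `&` K = set0 -> P A = 0%E.
  move=> mA AK; rewrite /P/= diracE memNset// => Ax.
  have : (A `&` K) (\val x) by split => //; exact/set_mem/valP.
  by rewrite AK.
have i1 : P.-integrable setT (EFin \o cst 1) by exact: finite_measure_integrable_cst.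
have d0 : radon_nonneg (density_radon PK i1) by apply: density_radon_nonneg => y /=.
exists (density_radon PK i1) => // g.
rewrite (@pairing_density _ _ _ P (cst 1))//.
under eq_Rintegral do rewrite mulr1.
rewrite /Rintegral integral_dirac//; last by apply/measurable_EFinP; case: (bm g).
by rewrite diracT mul1e /= -[RHS](valL0_val g).
Qed.

Context (I : finType) (f : continuousType K R) (g : I -> continuousType K R).
Hypothesis g0 : forall i x, 0 <= g i x.

Let g0' i y : 0 <= valL_ 0 (g i) y.
Proof. exact: (valL0_ind (P := fun _ z => 0 <= z)). Qed.

(** [D] is the derivative of [ell] at [mustar]. Perturbing [mustar] in the direction [- D] changes
    [ell] at first order by minus the integral of the square of [D], so minimality forces [D] to
    vanish almost everywhere. *)
Lemma ell_argmin_stationary (mustar : radon K) :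
  ell_argmin f g mustar -> ell_dom g mustar ->
  radon_pos mustar [set x | valL_ 0 f x -
    \sum_i valL_ 0 (g i) x / pairing mustar (g i) != 0] = 0%E.
Proof.
move=> [mu0 mu_min] mu_dom; have v0 i : 0 < pairing mustar (g i) by case: mu_dom.
pose Q := radon_pos mustar; pose v i := pairing mustar (g i).
pose D x := valL_ 0 f x - \sum_i valL_ 0 (g i) x / v i.
have bD : bounded_measurable D.
  apply: bounded_measurableD => //; apply: bounded_measurableN.
  apply: bounded_measurable_sum => i; apply: bounded_measurableM => //.
  exact: bounded_measurable_cst.
have iQ h : bounded_measurable h -> Q.-integrable setT (EFin \o h).
  exact: bounded_measurable_integrable.
have vE (h : continuousType K R) : pairing mustar h = \int[Q]_x valL_ 0 h x.
  exact: pairing_nonneg.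
pose b := \int[Q]_x (valL_ 0 f x * D x).
pose w i := \int[Q]_x (valL_ 0 (g i) x * D x).
have bDD : bounded_measurable (fun x => D x * D x) by exact: bounded_measurableM.
have DD0 : \int[Q]_x (D x * D x) = b - \sum_i w i / v i.
  transitivity (\int[Q]_x (valL_ 0 f x * D x -
      \sum_i (v i)^-1 * (valL_ 0 (g i) x * D x))).
    apply: eq_Rintegral => x _; rewrite {1}/D mulrBl mulr_suml.
    congr (_ - _); apply: eq_bigr => i _.
    by rewrite mulrAC mulrC.
  have bgD i : bounded_measurable (fun x => valL_ 0 (g i) x * D x).
    exact: bounded_measurableM.
  rewrite RintegralB//; last 2 first.
  - exact/iQ/bounded_measurableM.
  - apply/iQ; apply: bounded_measurable_sum => i; exact: bounded_measurableZ.
  congr (_ - _); rewrite Rintegral_sum => [|i]; last exact/iQ/bounded_measurableZ.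
  by apply: eq_bigr => i _; rewrite RintegralZl ?(mulrC (w i))//; exact/iQ.
(* mustar is compared with the measures of density 1 - t D for small t. *)
have bw : b <= \sum_i w i / v i.
  apply: sum_ln1B_derivative.
  have [_ [M DM]] := bD.
  near=> t.
  have t0 : 0 < t by near: t; exact: nbhs_right_gt.
  (* This bound gives [t * D x <= 1/2], so the perturbed measure is nonnegative and stays in the
     domain of [ell]. *)
  have tM : t <= (2 * (`|M| + 1))^-1.
    by near: t; apply: nbhs_right_le; rewrite invr_gt0 mulr_gt0// ltr_wpDl.
  have tD x : 2^-1 <= 1 - t * D x.
    have MD : `|D x| <= `|M| + 1.
      by rewrite (le_trans (DM x))// (le_trans (ler_norm _))// lerDl.
    have : t * D x <= (2 * (`|M| + 1))^-1 * (`|M| + 1).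
      rewrite (le_trans (ler_norm _))// normrM (gtr0_norm t0).
      by rewrite ler_pM// ltW.
    by rewrite invfM mulfVK ?gt_eqF ?ltr_wpDl//; lra.
  pose h x := 1 - t * D x.
  have h0 x : 0 <= h x by rewrite (le_trans _ (tD x)).
  have bh : bounded_measurable h.
    apply: bounded_measurableD; first exact: bounded_measurable_cst.
    by apply: bounded_measurableN; exact: bounded_measurableZ.
  pose nu := density_radon (@radon_pos_carried mustar) (iQ h bh).
  have nu0 : radon_nonneg nu by exact: density_radon_nonneg.
  have nuE (k : continuousType K R) : pairing nu k =
      pairing mustar k - t * \int[Q]_x (valL_ 0 k x * D x).
    rewrite (@pairing_density _ _ _ Q h)//; last exact/iQ.
    have bkD : bounded_measurable (fun x => valL_ 0 k x * D x).
      exact: bounded_measurableM.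
    rewrite vE -RintegralZl//; last exact/iQ.
    rewrite -RintegralB//; last 2 first.
    - exact/iQ.
    - exact/iQ/bounded_measurableZ.
    by apply: eq_Rintegral => x _; rewrite /h; ring.
  have nug i : 2^-1 * v i <= pairing nu (g i).
    rewrite (@pairing_density _ _ _ Q h)//; last exact/iQ.
    rewrite /v vE -RintegralZl//; last exact/iQ.
    apply: le_Rintegral => //.
    - exact/iQ/bounded_measurableZ.
    - exact/iQ/bounded_measurableM.
    - by move=> x _; rewrite mulrC ler_wpM2l// tD.
  have nu_dom : ell_dom g nu.
    by split => // i; rewrite (lt_le_trans _ (nug i))// mulr_gt0//; exact: v0.
  have zE i : pairing nu (g i) = v i * (1 - t * (w i / v i)).
    rewrite nuE mulrBr mulr1 (mulrCA (v i)) (mulrC (v i)) divfK//.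
    by rewrite gt_eqF//; exact: v0.
  have z0 i : 0 < 1 - t * (w i / v i).
    by rewrite -(pmulr_rgt0 _ (v0 i)) -/(v i) -zE; case: nu_dom.
  (* After cancellation, minimality says that the sum of the [ln (1 - t * (w i / v i))] is at most
     [- t * b], the hypothesis of [sum_ln1B_derivative]. *)
  have := mu_min _ nu0; rewrite /ell !mem_set// lee_fin nuE -/b.
  under [in leRHS]eq_bigr do rewrite zE lnM ?posrE ?v0//.
  rewrite big_split/=; lra.
have D2 : \int[Q]_x (D x * D x) = 0.
  apply/eqP; rewrite eq_le DD0 subr_le0 bw/= -DD0.
  by apply: Rintegral_ge0 => x _; rewrite -expr2 sqr_ge0.
have := Rintegral_eq0 (iQ _ bDD) _ D2.
rewrite (_ : [set x | D x * D x != 0] = [set x | D x != 0]).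
  by apply => x; rewrite -expr2 sqr_ge0.
by apply/seteqP; split => x /=; rewrite mulf_eq0 orbb.
Unshelve. all: by end_near. Qed.

End radon_optimality.

(** * Convergence *)

Section em_convergence.
Context (R : realType) (p : nat) (K : set 'rV[R]_p) (cK : compact K).
Context (I : finType) (f : continuousType K R) (g : I -> continuousType K R).
Context (c : R) (c0 : 0 < c) (fc : forall x, c <= f x).
Hypothesis g0 : forall i x, 0 <= g i x.
Context (mu : nat -> radon K).
Hypothesis mu0_dom : ell_dom g (mu 0%N).
Hypothesis mu_step : forall k, em_step f g (mu k) (mu k.+1).

Let mK : measurable K.
Proof. by apply: closed_measurable_mx; exact: compact_closed. Qed.

Local Notation ef := (valL_ 0 f).
Local Notation eg := (fun i => valL_ 0 (g i)).
Local Notation P := (radon_pos (mu 0%N)).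

Let bm (k : continuousType K R) : bounded_measurable (valL_ 0 k).
Proof. by apply: bounded_measurable_valL0 => //; exact: cts_fun. Qed.

Let bg i : bounded_measurable (eg i). Proof. exact: bm. Qed.

Let eg0 i y : 0 <= eg i y.
Proof. exact: (valL0_ind (P := fun _ z => 0 <= z)). Qed.

Let efc y : ef y = 0 \/ c <= ef y.
Proof. by apply: (valL0_ind (P := fun _ z => z = 0 \/ c <= z)) => *; [right|left]. Qed.

Let ef_notin y : ef y = 0 -> ~ K y.
Proof.
apply: (valL0_ind (P := fun y z => z = 0 -> ~ K y)) => // x fx.
by have := fc x; rewrite fx leNgt c0.
Qed.

Let egf0 i y : ef y = 0 -> eg i y = 0.
Proof. by move=> /ef_notin Ky; rewrite valL0_notin. Qed.

Let iP h : bounded_measurable h -> P.-integrable setT (EFin \o h).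
Proof. exact: bounded_measurable_integrable. Qed.

Let u k i := pairing (mu k) (g i).
Let G := em_density ef eg u.

Let bG k : bounded_measurable (G k).
Proof. exact: (bounded_measurable_em_density (bm f) bg c0 efc). Qed.

Let em_step_factor k y :
  valL_ 0 (fun x : K => (f x)^-1 * \sum_i g i x / pairing (mu k) (g i)) y =
  em_factor ef eg (u k) y.
Proof.
apply: (valL0_ind (P := fun y z => z = em_factor ef eg (u k) y)) => [x|{}y Ky].
  rewrite /em_factor valL0_val; congr (_ * _).
  by apply: eq_bigr => i _; rewrite valL0_val.
by rewrite /em_factor valL0_notin// invr0 mul0r.
Qed.

(** The claims need a joint induction: the sign of the update factor uses positive pairings, the
    density formula uses a nonnegative [mu k], and the next pairings are positive by [em_pos]
    applied to densities. *)
Lemma em_iterate k : [/\ radon_nonneg (mu k), forall i, 0 < pairing (mu k) (g i),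
  forall x, 0 <= G k x &
  forall A, measurable A -> (mu k A = \int[P]_(x in A) (G k x)%:E)%E].
Proof.
elim: k => [|k [muk0 u0 G0 mukE]].
  have [mu00 u0] := mu0_dom; split => // A mA.
  rewrite -[RHS]/(\int[P]_(x in A) cst 1 x)%E integral_cst// mul1e.
  exact/esym/radon_nonneg_pos.
have bF : bounded_measurable (em_factor ef eg (u k)).
  exact: (bounded_measurable_em_factor (bm f) bg c0 efc).
have F0 x : 0 <= em_factor ef eg (u k) x by apply: (em_factor_ge0 eg0 c0 efc).
have GS0 x : 0 <= G k.+1 x by rewrite mulr_ge0.
have muSE A : measurable A -> (mu k.+1 A = \int[P]_(x in A) (G k.+1 x)%:E)%E.
  move=> mA; rewrite (mu_step k mA) radon_int_nonneg//; last exact: measurableI.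
  have iA : P.-integrable A (EFin \o G k.+1) by exact: bounded_measurable_integrable.
  rewrite -[RHS]fineK; last exact: integrable_fin_num.
  congr EFin; rewrite -/(Rintegral P A (G k.+1)) [RHS]Rintegral_mkcond.
  have b1F : bounded_measurable (fun x => \1_A x * em_factor ef eg (u k) x).
    by apply: bounded_measurableM => //; exact: bounded_measurable_indic.
  transitivity (\int[radon_pos (mu k)]_x (\1_A x * em_factor ef eg (u k) x)).
    rewrite Rintegral_mkcond; apply: eq_Rintegral => x _; rewrite /patch.
    rewrite indicE in_setI; case: (x \in A); last by rewrite mul0r.
    rewrite mul1r -em_step_factor andTb; case: ifPn => //.
    by rewrite notin_setE => Kx; rewrite valL0_notin.
  rewrite (@Rintegral_density _ _ _ _ P _ (G k))//; last first.
  - by move=> A' mA'; rewrite radon_nonneg_pos// mukE.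
  - exact: iP.
  apply: eq_Rintegral => x _; rewrite /patch indicE.
  by case: (x \in A); rewrite ?mul1r ?mul0r//= mulrC.
have muS0 : radon_nonneg (mu k.+1).
  by move=> A mA; rewrite muSE//; apply: integral_ge0 => x _; rewrite lee_fin.
split => // i.
rewrite (@pairing_density _ _ _ P (G k.+1))//; last exact: iP.
apply: (em_pos (bm f) bg eg0 c0 efc egf0) => //.
by rewrite -(@pairing_density _ _ _ P (G k) (mu k))//; exact: iP.
Qed.

Lemma pairing_em_iterate k (q : continuousType K R) :
  pairing (mu k) q = \int[P]_x (valL_ 0 q x * G k x).
Proof.
by have [mu0 _ G0 muE] := em_iterate k; apply: pairing_density => //; exact: iP.
Qed.

Lemma pairing_em_iterate_f k : pairing (mu k.+1) f = #|I|%:R.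
Proof.
rewrite pairing_em_iterate; apply: (em_mass bg egf0); first exact: bG.
- by move=> i; have [_ u0 _ _] := em_iterate k; exact: u0.
- by move=> i; rewrite /u pairing_em_iterate.
Qed.

(** * Optimality and density of the minimizer *)

Context (mustar : radon K).
Hypothesis mustar_min : ell_argmin f g mustar.
Hypothesis mustar_ac : abs_continuous mustar.
Hypothesis mu0_density : exists2 h : continuousType K R,
  (forall x : K, 0 < h x) & has_lebesgue_density (mu 0%N) h.

Let Q := radon_pos mustar.
Let v i := pairing mustar (g i).

Lemma argmin_dom : ell_dom g mustar.
Proof.
have [mu00 _] := mu0_dom; have [_ /(_ _ mu00)] := mustar_min.
by rewrite /ell (mem_set mu0_dom); case: ifPn => [/set_mem//|_]; rewrite leye_eq.
Qed.

Let mustar0 : radon_nonneg mustar. Proof. by case: mustar_min. Qed.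

Let v0 i : 0 < v i. Proof. by case: argmin_dom => _; exact. Qed.

Let vE (q : continuousType K R) : pairing mustar q = \int[Q]_x valL_ 0 q x.
Proof. exact: pairing_nonneg. Qed.

(** The Lebesgue density of [mu 0] is positive on K, so its null sets are Lebesgue-null on K and
    hence null for the absolutely continuous [mustar]. This gives access to a Radon-Nikodym
    derivative with respect to [mu 0]. *)
Lemma argmin_dominated : Q `<< P.
Proof.
apply/null_content_dominatesP => A mA PA0.
have [h h0 mu0h] := mu0_density; have [mu00 _] := mu0_dom.
have mu0A : mu 0%N A = 0%E by rewrite -PA0; exact/esym/radon_nonneg_pos.
have mAK : measurable (A `&` K) by exact: measurableI.
have mh : measurable_fun (A `&` K) (EFin \o valL_ 0 h).
  by apply/measurable_funTS/measurable_EFinP; case: (bm h).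
have hpos x : K x -> 0 < valL_ 0 h x.
  by apply: (valL0_ind (P := fun y z => K y -> 0 < z)).
have : (\int[lebesgue_rV p]_(x in A `&` K) `|(EFin \o valL_ 0%R h) x| = 0)%E.
  rewrite -[RHS]mu0A mu0h//; apply: eq_integral => x.
  by rewrite inE => -[_ Kx]; rewrite gee0_abs// lee_fin ltW// hpos.
move=> /(ae_eq_integral_abs _ mAK mh)[N [mN N0 AN]].
have LAK : lebesgue_rV p (A `&` K) = 0%E.
  apply: (subset_measure0 mAK mN _ N0) => x AKx; apply: AN => hx0.
  have hx : valL_ 0 h x = 0 by apply: EFin_inj; exact: hx0.
  by have := hpos x AKx.2; rewrite hx ltxx.
transitivity (mustar A); first exact: radon_nonneg_pos.
apply: (mustar_ac (_ : null_set (lebesgue_on K) A)) => // B mB BA.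
rewrite /lebesgue_on; apply: (subset_measure0 _ mAK _ LAK) => //.
  exact: measurableI.
exact: setSI.
Qed.

Let Z := [set x | ef x - \sum_i eg i x / v i != 0] `|` ~` K.

Let bD : bounded_measurable (fun x => ef x - \sum_i eg i x / v i).
Proof.
apply: bounded_measurableD => //; apply: bounded_measurableN.
apply: bounded_measurable_sum => i; apply: bounded_measurableM => //.
exact: bounded_measurable_cst.
Qed.

Let mD : measurable [set x | ef x - \sum_i eg i x / v i != 0].
Proof.
have := emeasurable_neq measurableT (measurable_int _ (iP bD)) 0%E.
by rewrite setTI.
Qed.

Let mZ : measurable Z.
Proof. by apply: measurableU => //; exact: measurableC. Qed.

Let QZ : Q Z = 0%E.
Proof.
apply/eqP; rewrite -measure_le0; apply: le_trans (measureU2 _ mD (measurableC mK)) _.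
rewrite [X in (X + _)%E](ell_argmin_stationary cK g0 mustar_min argmin_dom) add0e.
rewrite le_eqVlt; apply/orP; left; apply/eqP.
exact: radon_pos_carried (measurableC mK) (setICl K).
Qed.

Let sum_off_Z x : ~ Z x -> \sum_i eg i x / v i = ef x.
Proof.
move=> Zx; apply/esym/eqP; rewrite -subr_eq0; apply/negPn/negP => Dx.
by apply: Zx; left.
Qed.

(** The derivative is set to 0 on the [mustar]-null set [Z]: no mass is lost, and stationarity holds
    at every point where [r] is nonzero, not only almost everywhere. *)
Let rn : exists r : 'rV[R]_p -> R, [/\ forall x, 0 <= r x,
  P.-integrable setT (EFin \o r), forall x, r x != 0 -> ~ Z x &
  forall A, measurable A -> (Q A = \int[P]_(x in A) (r x)%:E)%E].
Proof.
have QP := argmin_dominated.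
pose k := fine \o Radon_Nikodym_SigmaFinite.f Q P.
have kE : EFin \o k = Radon_Nikodym_SigmaFinite.f Q P.
  by apply/funext => x /=; rewrite fineK// Radon_Nikodym_SigmaFinite.f_fin_num.
have ik : P.-integrable setT (EFin \o k).
  by rewrite kE; exact: Radon_Nikodym_SigmaFinite.f_integrable.
have k0 x : 0 <= k x by rewrite fine_ge0// Radon_Nikodym_SigmaFinite.f_ge0.
exists (k \_ (~` Z)); split.
- by move=> x; rewrite /patch; case: ifP.
- rewrite -restrict_EFin; apply/(integrable_mkcond _ (measurableC mZ)).
  by apply: (integrableS measurableT) => //; exact: measurableC.
- by move=> x; rewrite /patch; case: ifPn => [/set_mem//|_]; rewrite eqxx.
- move=> A mA; transitivity (Q (A `&` ~` Z)).
    rewrite -[in LHS](setUIDK A Z) measureU//; last 3 first.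
    + exact: measurableI.
    + exact: measurableD.
    + by rewrite setDE setIACA setICr setI0.
    rewrite [X in (X + _)%E](subset_measure0 _ mZ _ QZ) ?add0e// ?setDE//.
    exact: measurableI.
  rewrite (Radon_Nikodym_SigmaFinite.f_integral QP); last first.
    by apply: measurableI => //; exact: measurableC.
  by rewrite -kE integral_mkcondr; apply: eq_integral => x _; rewrite restrict_EFin.
Qed.

(** [h] need not be the density of [mustar]: it keeps the integrals against the [g i] and the zero
    set of [r]. The common zero set yields the last clause, by which [h] still detects the sets
    charged by [mustar]. *)
Lemma argmin_bounded_density : exists h : 'rV[R]_p -> R,
  [/\ bounded_measurable h, forall x, 0 <= h x,
      forall x, h x != 0 -> \sum_i eg i x / v i = ef x,
      forall i, \int[P]_x (eg i x * h x) = v i &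
      forall A, measurable A -> P (A `&` K `&` [set x | h x != 0]) = 0%E ->
        mustar A = 0%E].
Proof.
have [r [r0 ir rZ Qr]] := rn.
pose gq (j : 'I_#|I|) := eg (enum_val j).
have bgq j : bounded_measurable (gq j) by exact: bg.
have [h [bh h0 hr hg]] := exists_bounded_density bgq r0 ir.
have hrN x : (h x != 0) = (r x != 0).
  by apply/idP/idP; apply: contra_neq => /hr.
exists h; split => //.
- by move=> x; rewrite hrN => /rZ/sum_off_Z.
- move=> i; have := hg (enum_rank i); rewrite /gq enum_rankK => ->.
  by rewrite /v (pairing_density _ _ r0 ir)// => A mA; rewrite -Qr// radon_nonneg_pos.
- move=> A mA PA0; rewrite -radon_nonneg_pos// Qr//.
  have mh : measurable [set x | h x != 0].
    have := emeasurable_neq measurableT (measurable_int _ (iP bh)) 0%E.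
    by rewrite setTI.
  have mAh : measurable (A `&` K `&` [set x | h x != 0]).
    by apply: measurableI => //; exact: measurableI.
  have mr := measurable_int _ ir.
  transitivity (\int[P]_(x in A `&` K `&` [set x | h x != 0%R]) (r x)%:E)%E.
    rewrite integral_mkcond [RHS]integral_mkcond; apply: eq_integral => x _.
    rewrite /patch !in_setI; case: (x \in A) => //=.
    have [rx|rx] := eqVneq (r x) 0; first by rewrite rx; case: ifP.
    rewrite !mem_set//; first by rewrite /= hrN.
    by apply: contrapT => Kx; apply: (rZ x rx); right.
  by rewrite null_set_integral//; exact: measurable_funTS.
Qed.

(** Integrating the stationarity relation against [mustar] gives one unit per index, the same value
    as for the iterates from index 1 on. *)
Lemma pairing_argmin_f : pairing mustar f = #|I|%:R.
Proof.
have bgv i : bounded_measurable (fun x => (v i)^-1 * eg i x).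
  exact: bounded_measurableZ.
have iQ h : bounded_measurable h -> Q.-integrable setT (EFin \o h).
  exact: bounded_measurable_integrable.
rewrite vE; transitivity (\int[Q]_x \sum_i (v i)^-1 * eg i x).
  apply: (eq_Rintegral_null mZ QZ).
  - by case: (bm f).
  - by case: (bounded_measurable_sum (index_enum I) bgv).
  - by move=> x /sum_off_Z <-; apply: eq_bigr => i _; rewrite mulrC.
rewrite Rintegral_sum => [|i]; last exact: iQ.
rewrite (eq_bigr (fun=> 1)) ?sumr_const// => i _.
by rewrite RintegralZl -?vE ?mulVf ?gt_eqF//; exact: iQ.
Qed.

(** * Summability of the gap to the minimum *)

Let S k := \sum_i ln (v i / u k i).

Let u0 k i : 0 < u k i.
Proof. by have [_ uk0 _ _] := em_iterate k; exact: uk0. Qed.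

Let G0 k x : 0 <= G k x.
Proof. by have [_ _ Gk0 _] := em_iterate k; exact: Gk0. Qed.

Let SE k : S k = \sum_i ln (v i) - \sum_i ln (u k i).
Proof. by rewrite -sumrB; apply: eq_bigr => i _; rewrite ln_div ?posrE. Qed.

Let ell_argminE : ell f g mustar = (#|I|%:R - \sum_i ln (v i))%:E.
Proof. by rewrite /ell (mem_set argmin_dom) pairing_argmin_f. Qed.

(** The linear terms of [ell] agree at [mu k.+1] and [mustar], so [S k.+1] is exactly the gap to the
    minimum. At index 0 the pairing with [f] is not normalized, and [S 0] is kept apart. *)
Let ell_iterateE k : ell f g (mu k.+1) = (#|I|%:R - \sum_i ln (v i) + S k.+1)%:E.
Proof.
have [muk0 uk0 _ _] := em_iterate k.+1.
rewrite /ell mem_set// pairing_em_iterate_f; congr EFin.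
by rewrite SE addrA subrK.
Qed.

Let S_ge0 k : 0 <= S k.+1.
Proof.
have [muk0 _ _ _] := em_iterate k.+1; have [_ /(_ _ muk0)] := mustar_min.
by rewrite ell_argminE ell_iterateE lee_fin lerDl.
Qed.

Let sum_S_le h M N V phi s : bounded_measurable h -> (forall x, 0 <= h x) ->
  (forall x, h x <= M) -> (forall x, h x != 0 -> \sum_i eg i x / v i = ef x) ->
  (forall i, \int[P]_x (eg i x * h x) = v i) ->
  measurable V -> bounded_measurable phi -> (forall x, \1_V x <= phi x) ->
  0 < s <= 1 ->
  S 0%N + \sum_(k < N) S k.+1 <= M * #|I|%:R +
    M / s * (\int[P]_x (phi x * (ef x * G N.+1 x))) +
    ln s * \int[P]_x (\1_V x * (ef x * h x)).
Proof.
move=> bh h0 hM hopt hv mV bphi Vphi s01.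
have -> : S 0%N + \sum_(k < N) S k.+1 = \sum_(k < N.+1) S k by rewrite big_ord_recl.
rewrite -(pairing_em_iterate_f N) pairing_em_iterate.
exact: (sum_log_likelihood_ratio_le (bm f) bg eg0 c0 efc egf0 u0 v0).
Qed.

(** With [V] empty, [phi] zero and [s = 1], the localized terms of [sum_S_le] vanish and the bound
    no longer depends on [N]. *)
Lemma exists_log_likelihood_bound : exists M, forall N, \sum_(k < N) S k.+1 <= M.
Proof.
have [h [bh h0 hopt hv _]] := argmin_bounded_density.
have [_ [M hM]] := bh.
exists (M * #|I|%:R - S 0%N) => N; rewrite lerBrDl.
have := @sum_S_le h M N set0 (cst 0) 1 bh h0
  (fun x => le_trans (ler_norm _) (hM x)) hopt hv measurable0
  (bounded_measurable_cst _ 0).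
rewrite ln1 mul0r addr0 ltr01 lexx; under eq_Rintegral do rewrite mul0r.
rewrite Rintegral_cst// !mul0r mulr0 addr0; apply=> //.
by move=> x; rewrite indic0.
Qed.

Lemma cvg_ell_em : ell f g (mu k) @[k --> \oo] --> ell_min f g.
Proof.
have -> : ell_min f g = ell f g mustar.
  apply/eqP; rewrite eq_le; apply/andP; split.
    by apply: ereal_inf_lbound; exists mustar.
  by apply: le_ereal_inf_tmp => _ [nu nu0 <-]; case: mustar_min => _; exact.
rewrite -(cvg_shiftS (fun k => ell f g (mu k))) /=.
under eq_fun do rewrite ell_iterateE; rewrite ell_argminE.
apply: cvg_EFin; first exact: nearW.
(* The partial sums are nondecreasing and bounded, so the series converges and its terms tend to
   0. *)
have S_cvg0 : S k.+1 @[k --> \oo] --> (0 : R).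
  apply: cvg_series_cvg_0; apply: nondecreasing_is_cvgn.
    by apply/nondecreasing_seqP => k; rewrite seriesSr lerDl.
  have [M SM] := exists_log_likelihood_bound.
  by exists M => _ [N _ <-]; rewrite seriesEord; exact: SM.
rewrite -[X in _ --> X]addr0; apply: cvgD; first exact: cvg_cst.
exact: S_cvg0.
Qed.

(** * Supports of the limit points *)

Lemma em_cluster_support_sub mubar : cluster (mu k @[k --> \oo]) mubar ->
  radon_support mubar `<=` Ktilde g.
Proof.
move=> cmu x; apply: contraPP => xK; rewrite /radon_support /=.
have oU : open (~` Ktilde g).
  apply/closed_openC/closed_bigcup; first exact: finite_finset.
  by move=> i _; exact: closed_closure.
move=> /(_ _ oU xK)[A [mA AU]]; apply/negP; rewrite negbK; apply/eqP.
apply: (pairing_eq0_null cK oU) => // psi cpsi psi0 _.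
pose q : continuousType K R := mkcts (@restriction_continuous _ _ K psi cpsi).
(* From index 1 on the density contains an update factor, which vanishes where all the [g i] do, in
   particular off [Ktilde g]; [mu 0] has no such factor, hence the shift. *)
have q0 k : pairing (mu k.+1) q = 0.
  rewrite pairing_em_iterate (@eq_Rintegral _ _ _ P setT (cst 0)).
    by rewrite Rintegral_cst// mul0r.
  move=> y _; have [Ky|Ky] := pselect (K y); last by rewrite valL0_notin// mul0r.
  have yE : y = \val (SigSub (mem_set Ky) : K) by [].
  have [Uy|Uy] := pselect ((~` Ktilde g) y); last first.
    have -> : valL_ 0 q y = psi y by exact: (valL0_val q (SigSub (mem_set Ky))).
    by rewrite psi0 ?mul0r.
  have -> : G k.+1 y = G k y * em_factor ef eg (u k) y by [].
  rewrite /em_factor big1 ?mulr0// => i _.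
  rewrite yE valL0_val (_ : g i _ = 0) ?mul0r//.
  apply/eqP/negPn/negP => gi; apply: Uy; exists i => //.
  by apply: subset_closure; exists (SigSub (mem_set Ky)).
(* A nonzero pairing with [mubar] is taken as its own tolerance: an iterate with zero pairing cannot
   be strictly closer. *)
apply/eqP; rewrite -normr_le0 leNgt; apply/negP => q_gt0.
have [[|k]// _] := cluster_pairing q 1 cmu q_gt0.
by rewrite q0 sub0r normrN ltxx.
Qed.

(** If [mubar] were null near [x], some iterate of positive index would have little mass there, and
    [sum_S_le] with a small [s] would make a sum of nonnegative gaps negative. *)
Lemma em_cluster_support_sup mubar : cluster (mu k @[k --> \oo]) mubar ->
  radon_support mustar `<=` radon_support mubar.
Proof.
move=> cmu x xstar U oU Ux; apply: contrapT => /forallNP mubarU.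
have {}mubarU A : measurable A -> A `<=` U -> mubar A = 0%E.
  move=> mA AU; apply: contrapT => /eqP muA.
  by apply: (mubarU A); split.
have [psi [cpsi psi01 psiU]] := open_cozero oU.
have psix : 0 < psi x by apply/psiU.
(* On this set [2 / psi x * psi y] exceeds 1, so a continuous function vanishing off [U] dominates
   the indicator of [V]. *)
pose V0 := [set y | psi x / 2 < psi y].
have oV0 : open V0.
  by move: cpsi => /continuousP/(_ _ (@open_gt _ (psi x / 2))).
have V0x : V0 x by rewrite /V0 /= ltr_pdivrMr// ltr_pMr// ltr1n.
have [A [mA AV mustarA]] := xstar _ oV0 V0x.
have [h [bh h0 hopt hv hA]] := argmin_bounded_density.
pose V := V0 `&` K.
have mV : measurable V by apply: measurableI => //; exact: open_measurable_mx.
have bV : bounded_measurable (fun y => \1_V y * (ef y * h y)).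
  by apply: bounded_measurableM; [exact: bounded_measurable_indic|exact: bounded_measurableM].
have V_pos y : 0 <= \1_V y * (ef y * h y).
  rewrite mulr_ge0// ?indicE ?ler0n// mulr_ge0//.
  by case: (efc y) => [->//|]; apply: le_trans; exact: ltW.
(* A zero integral would make [h] vanish almost everywhere on [V], and [hA] would then make [A] null
   for [mustar]. *)
have kappa0 : 0 < \int[P]_y (\1_V y * (ef y * h y)).
  rewrite lt0r Rintegral_ge0 ?andbT; last by move=> y _; exact: V_pos.
  apply/eqP => int0; move/eqP: mustarA; apply; apply: hA => //.
  have mVh : measurable [set y | \1_V y * (ef y * h y) != 0].
    have := emeasurable_neq measurableT (measurable_int _ (iP bV)) 0%E.
    by rewrite setTI.
  apply: (subset_measure0 _ mVh _ (Rintegral_eq0 (iP bV) V_pos int0)).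
    apply: measurableI; first exact: measurableI.
    have := emeasurable_neq measurableT (measurable_int _ (iP bh)) 0%E.
    by rewrite setTI.
  move=> y [[/AV V0y Ky] /= hy]; rewrite indicE mem_set// mul1r mulf_eq0 negb_or hy.
  by rewrite andbT; apply/eqP => /ef_notin.
set kappa := \int[P]_y _ in kappa0.
have [_ [M hM]] := bh; have M0 : 0 <= M by exact: le_trans (hM 0).
have [_ [F efF]] := bm f; have F0 : 0 <= F by exact: le_trans (efF 0).
(* With this [b], [ln s * kappa] is minus the absolute value in the numerator, which exceeds the
   constant part of the bound by at least 1; the absolute value also ensures [s <= 1]. *)
pose b := `|M * #|I|%:R - S 0%N + 1| / kappa.
pose s := expR (- b).
have b0 : 0 <= b by rewrite divr_ge0// ltW.
have s01 : 0 < s <= 1 by rewrite expR_gt0 -expR0 ler_expR oppr_le0.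
pose phi y := 2 / psi x * psi y.
have cphi : continuous phi.
  by move=> y; apply: cvgMr; [exact: nbhs_filter|exact: cpsi].
have phi0 y : 0 <= phi y.
  by rewrite !mulr_ge0// ?invr_ge0 ?(ltW psix)//; case/andP: (psi01 y).
have bphi : bounded_measurable phi.
  apply: bounded_measurableZ; split; first exact: continuous_measurable_mx.
  by exists 1 => y; have /andP[? ?] := psi01 y; rewrite ger0_norm.
have Vphi y : \1_V y <= phi y.
  rewrite indicE; have [/set_mem[V0y _]|_] := boolP (y \in V); last exact: phi0.
  by rewrite /phi mulrAC ler_pdivlMr// mul1r mulrC -ler_pdivrMr// ltW.
pose q : continuousType K R := mkcts (@restriction_continuous _ _ K phi cphi).
have q0 : pairing mubar q = 0.
  apply: (pairing_null cK (open_measurable_mx oU) mubarU) => y Uy.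
  suff psiy : psi (\val y) = 0 by exact: etrans (congr1 _ psiy) (mulr0 _).
  apply/eqP; have /andP[psi0 _] := psi01 (\val y).
  by rewrite eq_le psi0 andbT leNgt; apply/negP => /psiU.
(* This tolerance makes the term in [M / s] at most 1/2, so the sum of gaps would be at most -1/2;
   the added 1 keeps the denominator positive. *)
pose e := s / (2 * (M * F + 1)).
have MF0 : 0 <= M * F by rewrite mulr_ge0.
have e0 : 0 < e by rewrite divr_gt0 ?expR_gt0// mulr_gt0// ltr_wpDl.
have [[|N]// _] := cluster_pairing q 1 cmu e0.
rewrite q0 subr0 => /(le_lt_trans (ler_norm _)) qe.
have phifG : \int[P]_y (phi y * (ef y * G N.+1 y)) <= F * e.
  apply: (@le_trans _ _ (F * pairing (mu N.+1) q)); last by rewrite ler_wpM2l// ltW.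
  have bqG : bounded_measurable (fun y => valL_ 0 q y * G N.+1 y).
    exact: bounded_measurableM.
  rewrite pairing_em_iterate -RintegralZl//; last exact: iP.
  apply: le_Rintegral => //.
  - apply: iP; apply: bounded_measurableM => //; exact: bounded_measurableM.
  - by apply: iP; exact: bounded_measurableZ.
  move=> y _; have [Ky|Ky] := pselect (K y); last first.
    by rewrite !valL0_notin// !mul0r !mulr0.
  have -> : valL_ 0 q y = phi y.
    exact: (valL0_val q (SigSub (mem_set Ky))).
  rewrite mulrCA; apply: ler_wpM2r; last exact: le_trans (ler_norm _) (efF y).
  exact: mulr_ge0 (phi0 y) (G0 N.+1 y).
have := sum_S_le N bh h0 (fun y => le_trans (ler_norm _) (hM y)) hopt hv mV bphi Vphi s01.
rewrite /s expRK -/kappa -/s mulNr divfK ?gt_eqF//.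
have S0 : 0 <= \sum_(k < N) S k.+1 by exact: sumr_ge0.
have : M / s * (\int[P]_y (phi y * (ef y * G N.+1 y))) <= 2^-1.
  apply: (@le_trans _ _ (M / s * (F * e))).
    by apply: ler_wpM2l => //; rewrite mulr_ge0// invr_ge0 expR_ge0.
  rewrite (_ : M / s * (F * e) = M * F / (2 * (M * F + 1))); last first.
    have sn0 : s != 0 by rewrite gt_eqF// expR_gt0.
    have Dn0 : M * F + 1 != 0 by rewrite gt_eqF// ltr_wpDl.
    by rewrite /e; field; rewrite sn0 Dn0.
  by rewrite ler_pdivrMr ?mulr_gt0 ?ltr_wpDl//; lra.
have := ler_norm (M * #|I|%:R - S 0%N + 1).
lra.
Qed.

End em_convergence.

(** [Wadj a x] is the pairing of [a] with the image under [W] of the Dirac mass at [x], a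
    nonnegative measure. *)
Lemma adjoint_ge0 (R : realType) (p : nat) (K : set 'rV[R]_p) (cK : compact K)
    (W : radon K -> radon K) (Wadj : continuousType K R -> continuousType K R)
    (a : continuousType K R) :
  (forall (mu : radon K) (g : continuousType K R),
    pairing (W mu) g = pairing mu (Wadj g)) ->
  (forall mu, radon_nonneg mu -> radon_nonneg (W mu)) ->
  (forall x, 0 <= a x) -> forall x, 0 <= Wadj a x.
Proof.
move=> W_adj W_nonneg a0 x; have [delta delta0 deltaE] := pairing_dirac cK x.
rewrite -deltaE -W_adj pairing_nonneg; first last.
- by apply: closed_measurable_mx; exact: compact_closed.
- exact: W_nonneg.
apply: Rintegral_ge0 => y _.
exact: (valL0_ind (P := fun _ z => 0 <= z)).
Qed.

Theorem theorem3p6 (R : realType) (p : nat) (K : set 'rV[R]_p)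
  (K_compact : compact K)
  (m : nat) (a : 'I_m -> continuousType K R)
  (a_ge0 : forall i x, 0 <= a i x)
  (W : R -> radon K -> radon K)
  (Wadj : R -> continuousType K R -> continuousType K R)
  (W_linear : forall t : R, 0 <= t <= 1 -> forall (c : R) (mu nu rho : radon K),
    is_lincomb c mu nu rho -> is_lincomb c (W t mu) (W t nu) (W t rho))
  (W_continuous : forall t : R, 0 <= t <= 1 -> continuous (W t))
  (W_adjoint : forall t : R, 0 <= t <= 1 -> forall (mu : radon K) (g : continuousType K R),
    pairing (W t mu) g = pairing mu (Wadj t g))
  (W_nonneg : forall t : R, 0 <= t <= 1 -> forall mu : radon K,
    radon_nonneg mu -> radon_nonneg (W t mu))
  (W_measurable : forall g : continuousType K R, strongly_measurable (fun t => Wadj t g))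
  (W_integrable :
    (\int[lebesgue_measure]_(t in `[0%R, 1%R])
       (supnorm (Wadj t (cst (1 : R))))%:E < +oo)%E)
  (f : continuousType K R)
  (f_def : is_bochner_integral
    (fun t => Wadj t (adjointA a (const_mx 1))) f)
  (f_pos : exists2 c : R, 0 < c & forall x : K, c <= f x)
  (n : 'I_m -> nat) (tt : forall i, 'I_(n i) -> R)
  (tt01 : forall i j, 0 <= tt i j <= 1)
  (mustar_ex : exists mustar : radon K,
    [/\ ell_argmin f (gammas Wadj a tt) mustar,
        abs_continuous mustar &
        radon_support mustar = Ktilde (gammas Wadj a tt)])
  (mu : nat -> radon K)
  (mu0_dom : ell_dom (gammas Wadj a tt) (mu 0%N))
  (mu0_density : exists2 h : continuousType K R,
    (forall x : K, 0 < h x) & has_lebesgue_density (mu 0%N) h)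
  (mu_step : forall k, em_step f (gammas Wadj a tt) (mu k) (mu k.+1)) :
  ell f (gammas Wadj a tt) (mu k) @[k --> \oo]
    --> ell_min f (gammas Wadj a tt) /\
  forall mubar : radon K, cluster (mu k @[k --> \oo]) mubar ->
    radon_support mubar = Ktilde (gammas Wadj a tt).
Proof.
have [mustar [mustar_min mustar_ac mustar_supp]] := mustar_ex.
have [c c0 fc] := f_pos.
have gam0 s x : 0 <= gammas Wadj a tt s x.
  apply: (adjoint_ge0 K_compact (W := W (tt (tag s) (tagged s)))) => //.
  - exact: W_adjoint.
  - exact: W_nonneg.
split; first exact: (cvg_ell_em K_compact c0 fc gam0 mu0_dom mu_step mustar_min).
move=> mubar cmu; apply/seteqP; split.
  exact: (em_cluster_support_sub K_compact c0 fc gam0 mu0_dom mu_step cmu).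
rewrite -mustar_supp.
exact: (em_cluster_support_sup K_compact c0 fc gam0 mu0_dom mu_step mustar_min).
Qed.
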